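(* Let $K$ be a field of characteristic $0$ and let $S=K[x_1,\dots,x_n]$ be the standard graded polynomial ring. Let $I\subset S$ and $J\subset S$ be homogeneous ideals. Then for a general change of coordinates $g\in GL_n(K)$, $$H(I\,g(J),d)\ge H(I^{\mathrm{lex}}J^{\mathrm{oplex}},d)\quad\text{for all } d\ge 0.$$
   Context: $H(M,d)=\dim_K M_d$ denotes the Hilbert function of a finitely generated graded $S$-module $M$. Each $h=(a_{ij})\in GL_n(K)$ is identified with the $K$-algebra automorphism (change of coordinates) of $S$ given by $h(x_i)=\sum_{j=1}^n a_{ji}x_j$. A property holds for a general $g\in GL_n(K)$ if there is a non-empty Zariski open subset $U\subset GL_n(K)$ such that it holds for all $g\in U$. Let $>_{\mathrm{lex}}$ be the lexicographic order induced by $x_1>\cdots>x_n$ and $>_{\mathrm{oplex}}$ the lexicographic order induced by $x_n>\cdots>x_1$. A set $W$ of monomials of $S$ is lex (resp. opposite lex) if for all monomials $u,v$ of the same degree, $u\in W$ and $v>_{\mathrm{lex}}u$ (resp. $v>_{\mathrm{oplex}}u$) imply $v\in W$. A monomial ideal is a lex ideal (resp. opposite lex ideal) if its set of monomials is lex (resp. opposite lex). For a homogeneous ideal $I\subset S$, $I^{\mathrm{lex}}$ (resp. $I^{\mathrm{oplex}}$) denotes the unique lex (resp. opposite lex) ideal with the same Hilbert function as $I$ (it exists by Macaulay's theorem). *)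

(* Defs.v *)
From HB Require Import structures.
From mathcomp Require Import all_boot all_order all_algebra.
From mathcomp Require Import boolp classical_sets.
From mathcomp Require Import mpoly.

Set Implicit Arguments.
Unset Strict Implicit.
Unset Printing Implicit Defensive.

Import Order.TTheory GRing.Theory.

Local Open Scope classical_set_scope.
Local Open Scope ring_scope.

Section Ideals.
Context {K : fieldType} {n : nat}.
Local Notation S := {mpoly K[n]}.

(* The unit ideal is allowed, unlike with [idealr_closed] of ring_quotient. *)
Definition is_ideal (I : set S) : Prop :=
  [/\ I 0,
      forall p q, I p -> I q -> I (p + q)
    & forall a p, I p -> I (a * p)].

Definition is_homogeneous_ideal (I : set S) : Prop :=
  is_ideal I /\ forall p d, I p -> I (pihomog mdeg d p).

Definition ideal_gen (A : set S) : set S :=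
  [set p | exists s : seq (S * S),
     (forall x, x \in s -> A x.2) /\ p = \sum_(x <- s) x.1 * x.2].

Definition ideal_mul (I J : set S) : set S :=
  ideal_gen [set p * q | p in I & q in J].

Definition is_monomial_ideal (I : set S) : Prop :=
  exists M : set 'X_{1..n}, I = ideal_gen [set 'X_[m] | m in M].

(* The automorphism h of S with h(x_i) = \sum_j a_ji x_j, where h = (a_ij). *)
Definition coord_change (h : 'M[K]_n) (p : S) : S :=
  p \mPo [tuple \sum_(j < n) h j i *: 'X_j | i < n].

End Ideals.

(* The index i : 'I_n stands for the variable x_{i+1}: the exponent vectors   *)
(* are compared at the first, resp. last, index where they differ.            *)
Definition lex_gt n (v u : 'X_{1..n}) : bool :=
  ((multinom_val u : n.-tuplelexi nat) < multinom_val v)%O.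

Definition oplex_gt n (v u : 'X_{1..n}) : bool :=
  lex_gt [multinom v (rev_ord i) | i < n] [multinom u (rev_ord i) | i < n].

Definition segment_closed n (gt : rel 'X_{1..n}) (W : set 'X_{1..n}) : Prop :=
  forall u v, mdeg u = mdeg v -> W u -> gt v u -> W v.

Section LexIdeals.
Context {K : fieldType} {n : nat}.
Implicit Types L : set {mpoly K[n]}.

Definition is_lex_ideal L : Prop :=
  is_monomial_ideal L /\ segment_closed (@lex_gt n) [set m | L 'X_[m]].

Definition is_oplex_ideal L : Prop :=
  is_monomial_ideal L /\ segment_closed (@oplex_gt n) [set m | L 'X_[m]].

End LexIdeals.

(* The vector space structure on forms of degree d, [dhomog], is only         *)
(* available in n.+1 variables.                                               *)
Section Hilbert.
Context {K : fieldType} {n : nat}.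
Local Notation S := {mpoly K[n.+1]}.

(* For an ideal I this is the degree d component of I, see [homog_partP];     *)
(* the default value 0 is never used then.                                    *)
Definition homog_part (I : set S) (d : nat) : {vspace dhomog n.+1 K d} :=
  xget 0%VS
    [set V : {vspace dhomog n.+1 K d} | forall p, p \in V <-> I (val p)].

Definition hilbert (I : set S) (d : nat) : nat := \dim (homog_part I d).

Lemma homog_partP (I : set S) d (p : dhomog n.+1 K d) :
  is_ideal I -> p \in homog_part I d <-> I (val p).
Proof.
case=> I0 ID IM; rewrite /homog_part.
suff [V VP] : exists V : {vspace dhomog n.+1 K d},
    forall q, q \in V <-> I (val q).
  by case: xgetP => [W _ WP|/(_ V)] //; exact: WP.
pose sub (V : {vspace dhomog n.+1 K d}) := forall q, q \in V -> I (val q).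
pose P k := `[< exists2 V, sub V & \dim V = k >].
have exP : exists k, P k.
  exists 0%N; apply/asboolP; exists 0%VS; last exact: dimv0.
  by move=> q; rewrite memv0 => /eqP ->.
have leP k : P k -> (k <= \dim {: dhomog n.+1 K d})%N.
  by case/asboolP=> V _ <-; exact/dimvS/subvf.
case: (ex_maxnP exP leP) => k /asboolP [V subV dimV] maxk.
exists V => q; split=> [|Iq]; first exact: subV.
suff /maxk : P (\dim (V + <[q]>)%VS).
  rewrite -dimV => le_dim.
  have /eqP -> : (V == V + <[q]>)%VS by rewrite eqEdim addvSl.
  exact/(subvP (addvSr V <[q]>))/memv_line.
apply/asboolP; exists (V + <[q]>)%VS => // r.
case/memv_addP=> u Vu [w /vlineP [c ->] ->].
apply: (ID (val u)); first exact: subV.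
have -> : val (c *: q) = c%:MP * val q by rewrite mul_mpolyC.
exact: IM.
Qed.

(* [is_lex_of I L] reads L = I^lex: the lex ideal with the Hilbert function   *)
(* of I is unique, and exists for homogeneous I by Macaulay's theorem.        *)
Definition is_lex_of (I L : set S) : Prop :=
  is_lex_ideal L /\ forall d, hilbert L d = hilbert I d.

Definition is_oplex_of (I L : set S) : Prop :=
  is_oplex_ideal L /\ forall d, hilbert L d = hilbert I d.

End Hilbert.

Section General.
Context {K : fieldType} {n : nat}.

(* Zariski open subsets of GL_n(K) are its traces of complements of common    *)
(* zero loci of polynomials in the n * n matrix entries.                      *)
Definition zariski_open_GL (U : set 'M[K]_n) : Prop :=
  exists F : set {mpoly K[n * n]}, forall g,
    U g <-> g \in unitmx /\ exists2 f, F f & f.@[mxvec g 0] != 0.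

Definition for_general (P : 'M[K]_n -> Prop) : Prop :=
  exists U : set 'M[K]_n,
    [/\ zariski_open_GL U, U !=set0 & forall g, U g -> P g].

End General.

(* Main.v *)
Require Import Defs.
From mathcomp Require Import all_boot all_order all_algebra.
From mathcomp Require Import boolp classical_sets.
From mathcomp Require Import zify ring.
From mathcomp Require Import mpoly.

(* Degenerate I to a monomial ideal V which, in degrees <= d, is strongly stable, and J
   to a monomial ideal W strongly stable for the reversed order of the variables; for a
   general g the dimension of (I g(J))_d is at least the number of monomials of
   degree d in V W. For such V and W a monomial of V W factors uniquely as u v with u
   a minimal generator of V, v in W and max(u) <= min(v), so that
     |(V W)_d| = sum over the minimal generators u of V of
                 #{v in W of degree d - deg u in the variables x_i, i >= max(u)},
   and symmetrically in V and W. By Green's theorem, here a statement on strongly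
   stable sets of monomials, these numbers decrease when W is replaced by J^oplex,
   and then when V is replaced by I^lex. For all d to be handled by a single open set,
   the leading monomials of I g(J) for generic g are finitely generated (Dickson). *)

Set Implicit Arguments.
Unset Strict Implicit.
Unset Printing Implicit Defensive.

Import Order.TTheory GRing.Theory.

(** * Strongly stable sets of monomials and lex segments *)

(** The limits [V] and [W] depend on [d]: they are found by maximizing over the monomials of degree
    at most [d], a finite set, so they yield one good matrix for each [d]. The passage to an open
    set independent of [d] goes through [generic_lead], where the entries of g are treated as
    indeterminates: a single matrix at which products of forms are independent bounds the number of
    generic leading monomials in degree [d] from below. The factors are degenerated separately, each
    by its own coordinate change, although only one g is available and it acts on J alone. Two facts
    reconcile this: independence of the products follows from the nonvanishing of a determinant, an
    inequation that passes from a limit to the forms converging to it, one factor at a time; and a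
    common coordinate change of both factors preserves independence. Characteristic 0 enters through
    the binomial coefficients produced by shears and through the infinitude of K, which provides
    nonroots. *)

Lemma seq_least (T : eqType) (r : rel T) (s : seq T) :
    total r -> transitive r -> s != [::] ->
  exists2 w, w \in s & {in s, forall v, r w v}.
Proof.
move=> r_total r_trans; elim: s => // x s IH _.
have rxx : r x x by have := r_total x x; rewrite orbb.
have [->|/IH[w ws wP]] := eqVneq s [::].
  by exists x => [|v]; rewrite inE // => /eqP ->.
have [xw|wx] := orP (r_total x w).
  exists x => [|v]; first exact: mem_head.
  by rewrite inE => /predU1P[-> //|/wP]; exact: r_trans.
exists w => [|v]; first by rewrite inE ws orbT.
by rewrite inE => /predU1P[->|/wP].
Qed.

Section Counting.
Context {n : nat}.
Implicit Types (u v w m : 'X_{1..n}) (P Q V L : pred 'X_{1..n}).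

Definition monos a : seq 'X_{1..n} :=
  [seq bmnm m | m : 'X_{1..n < a.+1} <- enum {: 'X_{1..n < a.+1}} & mdeg (bmnm m) == a].

Lemma mem_monos a m : (m \in monos a) = (mdeg m == a).
Proof.
apply/mapP/eqP => [[b] | dm].
  by rewrite mem_filter => /andP[/eqP db _] ->.
have lt_m : mdeg m < a.+1 by rewrite dm.
by exists (BMultinom lt_m) => //; rewrite mem_filter mem_enum andbT; apply/eqP.
Qed.

Lemma monos_uniq a : uniq (monos a).
Proof. by rewrite map_inj_uniq ?filter_uniq -?enumT ?enum_uniq // => x y; apply: val_inj. Qed.

Definition cnt a P := count P (monos a).

Lemma eq_cnt a P Q : (forall u, mdeg u = a -> P u = Q u) -> cnt a P = cnt a Q.
Proof. by move=> PQ; apply: eq_in_count => u; rewrite mem_monos => /eqP /PQ. Qed.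

Lemma cnt_inj a b P Q (f : 'X_{1..n} -> 'X_{1..n}) :
    (forall u, mdeg u = a -> P u -> mdeg (f u) = b /\ Q (f u)) ->
    (forall u v, mdeg u = a -> mdeg v = a -> P u -> P v -> f u = f v -> u = v) ->
  cnt a P <= cnt b Q.
Proof.
move=> fQ f_inj; rewrite /cnt -!size_filter -(size_map f).
apply: uniq_leq_size => [|_ /mapP[u + ->]]; last first.
  rewrite !mem_filter !mem_monos => /andP[Pu /eqP du]; have [-> ->] := fQ u du Pu; exact: eqxx.
rewrite map_inj_in_uniq ?filter_uniq ?monos_uniq // => u v.
rewrite !mem_filter !mem_monos => /andP[Pu /eqP du] /andP[Pv /eqP dv].
exact: f_inj.
Qed.

Lemma sub_cnt a P Q :
  (forall u, mdeg u = a -> P u -> Q u) -> cnt a P <= cnt a Q.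
Proof. by move=> PQ; apply: (@cnt_inj a a P Q id) => // u du Pu; split; auto. Qed.

Lemma cnt_gt0P a P : reflect (exists2 u, mdeg u = a & P u) (0 < cnt a P).
Proof.
rewrite /cnt -has_count; apply: (iffP hasP) => [[u]|[u du Pu]]; exists u => //.
  by apply/eqP; rewrite -mem_monos.
by rewrite mem_monos du.
Qed.

Lemma cnt_split a (o : 'I_n) P :
  cnt a P = \sum_(k < a.+1) cnt a [pred u | P u && (u o == k)].
Proof.
under eq_bigr do rewrite /cnt -sum1_count big_mkcond.
rewrite exchange_big /= /cnt -sum1_count big_mkcond /=.
rewrite big_seq_cond [RHS]big_seq_cond; apply: eq_bigr => u.
rewrite mem_monos andbT => /eqP du; case: (P u) => /=; last by rewrite big1.
have uo : u o < a.+1 by rewrite ltnS -du mdegE (bigD1 o) //= leq_addr.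
rewrite (bigD1 (Ordinal uo)) //= eqxx big1 ?addn0 // => k.
by rewrite -val_eqE /= eq_sym => /negbTE ->.
Qed.

(** Monomials in the first [i] variables. Indices start at 0: [low o] excludes x_o and [low o.+1]
    admits it. *)
Definition low i u := [forall j : 'I_n, (i <= j) ==> (u j == 0)].

Lemma lowP i u : reflect (forall j : 'I_n, i <= j -> u j = 0) (low i u).
Proof.
apply: (iffP forallP) => [uP j ij|uP j]; first exact/eqP/(implyP (uP j)).
by apply/implyP => /uP ->.
Qed.

Lemma low_succ (o : 'I_n) u : low o u = low o.+1 u && (u o == 0).
Proof.
apply/lowP/andP => [uP|[/lowP uP /eqP u0] j].
  by split; [apply/lowP => j oj; apply: uP; apply: ltnW | rewrite uP].
by rewrite leq_eqVlt => /predU1P[/val_inj <- //|]; apply: uP.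
Qed.

Lemma low_size i u : n <= i -> low i u.
Proof. by move=> ni; apply/lowP => j; have := ltn_ord j; lia. Qed.

(** Trades x_i^k for x_j^k. The subtraction is truncated, whence the hypotheses [k <= u i] below. *)
Definition mshift k (i j : 'I_n) u := (u - U_(i) *+ k + U_(j) *+ k)%MM.

Lemma mshiftE k i j u l :
  mshift k i j u l = u l - (i == l) * k + (j == l) * k.
Proof. by rewrite /mshift !(mnmE, mulmnE). Qed.

Lemma mdeg_mshift k i j u : k <= u i -> mdeg (mshift k i j u) = mdeg u.
Proof.
move=> ku; have le_u : (U_(i) *+ k <= u)%MM.
  by apply/mnm_lepP => l; rewrite mulmnE mnmE; case: eqP => [<-|]; lia.
by rewrite /mshift mdegD mdegMn mdeg1 -{2}(submK le_u) mdegD mdegMn mdeg1.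
Qed.

Lemma mshiftK k i j u : k <= u i -> mshift k j i (mshift k i j u) = u.
Proof.
move=> ku; apply/mnmP => l; rewrite !mshiftE.
have [jl|jl] := eqVneq j l; have [il|il] := eqVneq i l; subst; lia.
Qed.

Lemma mshift0 (i j : 'I_n) u : mshift 0 i j u = u.
Proof. by apply/mnmP => l; rewrite mshiftE !muln0 subn0 addn0. Qed.

Lemma mshift_ltmc k (i j : 'I_n) u : j < i -> 0 < k <= u i ->
  (u < mshift k i j u)%O.
Proof.
move=> ji /andP[k0 ku]; apply/ltmcP; first by rewrite mdeg_mshift.
have ne_ij : (i == j) = false by rewrite -val_eqE /=; lia.
exists j => [l lj|]; rewrite mshiftE; last by rewrite ne_ij eqxx; lia.
by rewrite -!val_eqE /=; lia.
Qed.

Lemma mshift_back k l (i j : 'I_n) u : i != j -> l <= u i ->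
  mshift (l + k) j i (mshift l i j u) = mshift k j i u.
Proof.
move=> ij lu; apply/mnmP => x; rewrite !mshiftE.
have [jx|jx] := eqVneq j x; have [ix|ix] := eqVneq i x; try lia.
- by rewrite ix jx eqxx in ij.
- by subst x; lia.
Qed.

Definition sstable a V := forall u (j i : 'I_n),
  mdeg u = a -> V u -> j < i -> 0 < u i -> V (mshift 1 i j u).

Lemma sstable_mshift a V k u (j i : 'I_n) : sstable a V ->
  mdeg u = a -> V u -> j < i -> k <= u i -> V (mshift k i j u).
Proof.
move=> sV du Vu ji; elim: k => [|k IH] ku.
  by rewrite mshift0.
have -> : mshift k.+1 i j u = mshift 1 i j (mshift k i j u).
  apply/mnmP=> l; rewrite !mshiftE; have ne : j != i by rewrite -val_eqE /=; lia.
  have [jl|jl] := eqVneq j l; have [il|il] := eqVneq i l; subst => //; lia.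
apply: (sV) => //; first by rewrite mdeg_mshift //; lia.
  by apply: IH; lia.
by rewrite mshiftE eqxx; lia.
Qed.

(** Relative to the first [i] variables, since Green's theorem is proved by induction on their
    number. *)
Definition lexseg i a L := forall u v, mdeg u = a -> mdeg v = a ->
  low i u -> low i v -> L u -> (u < v)%O -> L v.

Lemma low_mshift (o o' : 'I_n) k u : o' = o.+1 :> nat -> k <= u o' ->
  low o'.+1 u -> u o' = k -> low o' (mshift k o' o u).
Proof.
move=> eo ku /lowP ul uk; apply/lowP => j; rewrite leq_eqVlt mshiftE.
case/predU1P => [/val_inj <-|o'j]; first by rewrite eqxx -val_eqE /=; lia.
by rewrite ul // -!val_eqE /=; lia.
Qed.

(* Replacing x_o'^k by x_o^k embeds the part of V with u o' = k into the part with
   k <= u o of V without x_o'. For L the reverse replacement is possible except at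
   the least monomial w of L without x_o', and there is room for leaving w out. *)
Lemma growth_step (o o' : 'I_n) : o' = o.+1 :> nat ->
    (forall a k V L, sstable a V -> lexseg o.+1 a L ->
      cnt a [pred u | low o.+1 u && V u] <= cnt a [pred u | low o.+1 u && L u] ->
      cnt a [pred u | [&& low o.+1 u, V u & k <= u o]]
        <= cnt a [pred u | [&& low o.+1 u, L u & k <= u o]]) ->
  forall a V L, sstable a V -> lexseg o'.+1 a L ->
    cnt a [pred u | low o' u && V u] < cnt a [pred u | low o' u && L u] ->
  forall k, cnt a [pred u | [&& low o'.+1 u, V u & u o' == k.+1]]
        <= cnt a [pred u | [&& low o'.+1 u, L u & u o' == k.+1]].
Proof.
move=> eo IH a V L sV lL ltVL k0; set k := k0.+1.
have neo : (o == o') = false by rewrite -val_eqE /=; lia.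
pose L0 := [pred u | low o' u && L u].
have [|w] := seq_least (s := filter L0 (monos a)) (@le_total _ _) (@le_trans _ _).
  by rewrite -size_eq0 size_filter -lt0n (leq_ltn_trans _ ltVL).
rewrite mem_filter mem_monos => /andP[/andP[lw Lw] /eqP dw] wmin.
pose L' := [pred u | L u && (u != w)].
have lL' : lexseg o.+1 a L'.
  move=> u v du dv; rewrite -eo => lu lv /andP[Lu uw] uv.
  have L'v : L v.
    by apply: (lL u) => //; move: lu lv; rewrite !low_succ => /andP[? _] /andP[? _].
  rewrite /= L'v; apply: contraTneq uv => ->; rewrite -leNgt.
  by apply: wmin; rewrite mem_filter mem_monos /= lu Lu du eqxx.
have eqL : cnt a [pred u | low o' u && L u]
    = (cnt a [pred u | low o.+1 u && L' u]).+1.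
  rewrite /cnt -eo -!size_filter -addn1.
  have <- : size [:: w] = 1%N by [].
  rewrite -size_cat; apply/perm_size/uniq_perm; last 1 first.
  - move=> u; rewrite mem_cat mem_seq1 !mem_filter mem_monos orbC /=.
    by have [->|_] := eqVneq u w; rewrite ?lw ?Lw ?dw ?eqxx ?andbT.
  - by rewrite filter_uniq // monos_uniq.
  - rewrite cat_uniq /= filter_uniq ?monos_uniq // orbF andbT.
    by rewrite mem_filter /= eqxx !andbF.
have leVL : cnt a [pred u | low o.+1 u && V u] <= cnt a [pred u | low o.+1 u && L' u].
  by move: ltVL; rewrite eqL -eo ltnS.
have oltn : o < o' by rewrite eo.
apply: (@leq_trans (cnt a [pred u | [&& low o.+1 u, V u & k <= u o]])).
  apply: (cnt_inj (f := mshift k o' o)) => [u du /and3P[lu Vu /eqP uk]|].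
    have ku : k <= u o' by rewrite uk.
    split; first by rewrite mdeg_mshift.
    rewrite /= -eo low_mshift // (sstable_mshift sV) //=.
    by rewrite mshiftE eqxx eq_sym neo; lia.
  move=> u v _ _ /and3P[_ _ /eqP uk] /and3P[_ _ /eqP vk] uv.
  by rewrite -(@mshiftK k o' o u) ?uk // uv mshiftK ?vk.
apply: leq_trans (IH a k V L' sV lL' leVL) _.
apply: (cnt_inj (f := mshift k o o')) => [u du /and3P[lu /andP[Lu uw] ku]|]; last first.
  move=> u v _ _ /and3P[_ _ uk] /and3P[_ _ vk] uv.
  by rewrite -(@mshiftK k o o' u) ?uk // uv mshiftK ?vk.
have du' : mdeg (mshift k o o' u) = a by rewrite mdeg_mshift.
have lu' : low o'.+1 (mshift k o o' u).
  apply/lowP => j jo; rewrite mshiftE (lowP _ _ lu); last by rewrite -eo ltnW.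
  by rewrite -!val_eqE /=; lia.
split=> //=; rewrite lu' mshiftE eqxx neo (lowP _ _ lu) ?eo //=.
rewrite mul1n sub0n add0n eqxx andbT; apply: (lL w) => //.
  by move: lw; rewrite low_succ => /andP[].
(* As [u] is not [w], it exceeds [w] at a first index [i]. Equality of degrees forces [i < o], so
   trading x_o for x_o' does not touch that index and the result stays above [w]. *)
have /ltmcP : (w < u)%O.
  rewrite lt_def uw; apply: wmin; rewrite mem_filter mem_monos /= eo lu Lu.
  exact/eqP.
rewrite dw du => /(_ erefl)[i eqi lti]; apply/ltmcP; first by rewrite dw.
have i_o : i < o.
  have : i < o'.
    by rewrite ltnNge; apply/negP => o'i; move: lti; rewrite (lowP _ _ lu i) // -eo.
  rewrite eo ltnS leq_eqVlt => /predU1P[/val_inj eio|//]; subst i.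
  have : mdeg w < mdeg u; last by rewrite dw du ltnn.
  rewrite !mdegE [X in X < _](bigD1 o) // [X in _ < X](bigD1 o) //=.
  rewrite -addSn leq_add // leq_sum // => j jo.
  have [/eqi -> //|oj] := ltnP j o.
  by rewrite (lowP _ _ lw) // eo ltn_neqAle oj andbT eq_sym val_eqE jo.
have ne_i : (o == i) = false /\ (o' == i) = false.
  by rewrite -!val_eqE /=; split; lia.
exists i => [j ji|]; rewrite mshiftE.
  by rewrite eqi // -!val_eqE /=; lia.
by rewrite !ne_i.1 !ne_i.2; lia.
Qed.

(** Induction on [k]: division by x_o replaces [V] and [L] by their colons in one degree less. The
    inequality of cardinalities passes to the colons by subtraction if [V] has at least as many
    monomials without x_o as [L], and otherwise by growth, one exponent of x_o at a time. *)
Lemma last_step (o : 'I_n) :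
    (forall a V L, sstable a V -> lexseg o.+1 a L ->
      cnt a [pred u | low o u && V u] < cnt a [pred u | low o u && L u] ->
      forall k, cnt a [pred u | [&& low o.+1 u, V u & u o == k.+1]]
        <= cnt a [pred u | [&& low o.+1 u, L u & u o == k.+1]]) ->
  forall a k V L, sstable a V -> lexseg o.+1 a L ->
    cnt a [pred u | low o.+1 u && V u] <= cnt a [pred u | low o.+1 u && L u] ->
    cnt a [pred u | [&& low o.+1 u, V u & k <= u o]]
      <= cnt a [pred u | [&& low o.+1 u, L u & k <= u o]].
Proof.
move=> H; have split0 a P : cnt a [pred u | low o.+1 u && P u] =
    cnt a [pred u | low o u && P u]
    + cnt a [pred u | [&& low o.+1 u, P u & 0 < u o]].
  rewrite /cnt -(count_predUI _ _ (monos a)) [X in _ = _ + X](_ : _ = 0) ?addn0.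
    apply: eq_count => u /=; rewrite low_succ.
    by case: (low o.+1 u); case: (P u); case: (u o).
  rewrite (@eq_count _ _ pred0) ?count_pred0 // => u /=.
  by rewrite low_succ; case: (u o) => [|m]; rewrite ?andbF ?andbT; case: (low o.+1 u); case: (P u).
have lt_low P a : cnt a [pred u | [&& low o.+1 u, P u & 0 < u o]] =
   \sum_(i < a) cnt a [pred u | [&& low o.+1 u, P u & u o == i.+1]].
  rewrite (cnt_split a o) big_ord_recl /= [X in X + _](_ : _ = 0) ?add0n.
    apply: eq_bigr => i _; apply: eq_cnt => u _ /=.
    by rewrite /bump /= add1n; case: (low o.+1 u); case: (P u); case: (u o).
  rewrite /cnt (@eq_count _ _ pred0) ?count_pred0 // => u /=.
  by case: (low o.+1 u); case: (P u); case: (u o).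
have div_last a k P : cnt a.+1 [pred u | [&& low o.+1 u, P u & k < u o]] =
    cnt a [pred u | [&& low o.+1 u, P (u + U_(o))%MM & k <= u o]].
  apply/eqP; rewrite eqn_leq; apply/andP; split.
    apply: (cnt_inj (f := fun u => (u - U_(o))%MM)) => [u du /and3P[lu Pu ku]|].
      have uK : (u - U_(o) + U_(o) = u)%MM by rewrite submK // lep1mP; lia.
      split; first by apply: succn_inj; rewrite -du -[in RHS]uK mdegD mdeg1 addn1.
      rewrite /= uK Pu mnmBE mnm1E eqxx -ltnS subn1 prednK ?ku ?andbT; last lia.
      by apply/lowP => j oj; rewrite mnmBE (lowP _ _ lu).
    move=> u v _ _ /and3P[_ _ ku] /and3P[_ _ kv] uv.
    by rewrite -(@submK _ U_(o) u) ?uv ?submK // lep1mP; lia.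
  apply: (cnt_inj (f := fun u => (u + U_(o))%MM)) => [u du /and3P[lu Pu ku]|].
    split; first by rewrite mdegD mdeg1 du addn1.
    rewrite /= Pu mnmDE mnm1E eqxx addn1 ltnS ku !andbT.
    apply/lowP => j oj; rewrite mnmDE (lowP _ _ lu) // mnm1E -val_eqE /=.
    by case: eqP => // oj'; move: oj; rewrite oj' ltnn.
  by move=> u v _ _ _ _ /addIm.
move=> a k; elim: k a => [|k IH] a V L sV lL leVL.
  have E P : cnt a [pred u | [&& low o.+1 u, P u & 0 <= u o]] =
             cnt a [pred u | low o.+1 u && P u].
    by apply: eq_cnt => u _ /=; rewrite andbT.
  by rewrite !E.
case: a sV lL leVL => [|a] sV lL leVL.
  rewrite leqNgt; apply/negP => /(leq_ltn_trans (leq0n _)) /cnt_gt0P[u /eqP].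
  by rewrite mdeg_eq0 => /eqP -> /and3P[_ _]; rewrite mnm0E.
rewrite !div_last; apply: (IH a (fun u => V (u + U_(o))%MM) (fun u => L (u + U_(o))%MM)).
- move=> u j i du Vu ji ui.
  have -> : (mshift 1 i j u + U_(o) = mshift 1 i j (u + U_(o)))%MM.
    apply/mnmP => l; rewrite !(mshiftE, mnmE); have [il|il] := eqVneq i l; last lia.
    by rewrite -{}il; lia.
  by apply: sV; rewrite ?mdegD ?mdeg1 ?du ?addn1 // mnmDE; lia.
- move=> u v du dv lu lv Lu uv; apply: (lL (u + U_(o))%MM);
    rewrite ?mdegD ?mdeg1 ?du ?dv ?addn1 //; last by rewrite ltmc_add2l.
  + apply/lowP => j oj; rewrite mnmDE (lowP _ _ lu) // mnm1E -val_eqE /=.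
    by case: eqP => // oj'; move: oj; rewrite oj' ltnn.
  + apply/lowP => j oj; rewrite mnmDE (lowP _ _ lv) // mnm1E -val_eqE /=.
    by case: eqP => // oj'; move: oj; rewrite oj' ltnn.
have E P : cnt a [pred u | low o.+1 u && P (u + U_(o))%MM] =
    cnt a.+1 [pred u | [&& low o.+1 u, P u & 0 < u o]].
  by rewrite div_last; apply: eq_cnt => u _ /=; rewrite andbT.
rewrite !E; have [geVL|ltVL] := leqP (cnt a.+1 [pred u | low o u && L u])
  (cnt a.+1 [pred u | low o u && V u]).
  by move: leVL; rewrite (split0 _ V) (split0 _ L); lia.
by rewrite !lt_low; apply: leq_sum => i _; apply: H.
Qed.

(** Growth at one variable gives, by [last_step], the hypothesis of [growth_step] at the next. At
    the first variable the strict inequality forces degree 0, where no exponent is positive. *)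
Lemma growth (o : 'I_n) a V L : sstable a V -> lexseg o.+1 a L ->
    cnt a [pred u | low o u && V u] < cnt a [pred u | low o u && L u] ->
  forall k, cnt a [pred u | [&& low o.+1 u, V u & u o == k.+1]]
        <= cnt a [pred u | [&& low o.+1 u, L u & u o == k.+1]].
Proof.
case: o => i i_n; elim: i i_n a V L => [|i IH] i_n a V L.
  move=> _ _ /(leq_ltn_trans (leq0n _)) /cnt_gt0P[u du /andP[/lowP u0 _]] k.
  have a0 : a = 0 by rewrite -du mdegE big1 // => j _; apply: u0.
  rewrite leqNgt; apply/negP => /(leq_ltn_trans (leq0n _)) /cnt_gt0P[v /eqP].
  by rewrite a0 mdeg_eq0 => /eqP -> /and3P[_ _]; rewrite mnm0E.
have i_n' := ltnW i_n; apply: (@growth_step (Ordinal i_n')) => // {}a k {}V {}L.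
by apply: last_step => {}a {}V {}L sV lL ltVL {}k; apply: (IH i_n').
Qed.

(* For V = I_a strongly stable, the left-hand side is the Hilbert function of
   I restricted to x_(i+1) = ... = x_n = 0, so this is Green's theorem. *)
Lemma cnt_low_lexseg a V L i : sstable a V -> lexseg n a L ->
    cnt a L <= cnt a V ->
  cnt a [pred u | low i u && L u] <= cnt a [pred u | low i u && V u].
Proof.
move=> sV lL leLV; have [ni|] := leqP n i.
  by have E P : cnt a [pred u | low i u && P u] = cnt a P;
    [apply: eq_cnt => u _ /=; rewrite low_size | rewrite !E].
move=> /ltnW i_n; move: {-2}(n - i)%N (erefl (n - i)%N) => k.
elim: k i i_n => [|k IH] i i_n ki.
  have E P : cnt a [pred u | low i u && P u] = cnt a P;
    [apply: eq_cnt => u _ /=; rewrite low_size //; lia | by rewrite !E].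
have lt_in : i < n by lia.
pose o := Ordinal lt_in.
have {}IH := IH i.+1 lt_in; have {}IH := IH ltac:(lia).
(* By growth, a deficit of [V] among the monomials without x_o is not made up in any positive
   exponent of x_o; it would remain with one variable more, against the induction, which descends
   from [i = n]. *)
rewrite leqNgt; apply/negP => ltVL.
have lLo : lexseg o.+1 a L.
  by move=> u v du dv _ _; apply: lL => //; apply: low_size.
have gr := growth sV lLo ltVL.
have split0 P : cnt a [pred u | low i.+1 u && P u] =
    cnt a [pred u | low i u && P u]
    + \sum_(k < a) cnt a [pred u | [&& low o.+1 u, P u & u o == k.+1]].
  rewrite (cnt_split a o) big_ord_recl /=; congr (_ + _).
    by apply: eq_cnt => u _ /=; rewrite (low_succ o) /= andbAC.
  by apply: eq_bigr => j _; apply: eq_cnt => u _ /=; rewrite andbA.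
move: IH; rewrite (split0 V) (split0 L) leqNgt => /negP[].
by rewrite -addSn leq_add // leq_sum.
Qed.

End Counting.

(** * Counting products of monomial ideals *)

Section ProductCount.
Context {n : nat}.
Implicit Types (u v w m p q : 'X_{1..n}) (I J L O : pred 'X_{1..n}).

Definition upset I := forall u m, I u -> I (u + m)%MM.

Definition costable a J := forall u (i j : 'I_n),
  mdeg u = a -> J u -> i < j -> 0 < u i -> J (mshift 1 i j u).

Definition high s u := [forall j : 'I_n, (j < s) ==> (u j == 0)].

Lemma highP s u : reflect (forall j : 'I_n, j < s -> u j = 0) (high s u).
Proof.
apply: (iffP forallP) => [uP j js|uP j]; first exact/eqP/(implyP (uP j)).
by apply/implyP => /uP ->.
Qed.

Definition mprod I J : pred 'X_{1..n} :=
  fun m => `[< exists u v, [/\ I u, J v & m = (u + v)%MM] >].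

(** In an [upset], testing division by single variables is enough for minimality. *)
Definition mingen I u :=
  I u && [forall k : 'I_n, (0 < u k) ==> ~~ I (u - U_(k))%MM].

(** For u = 1 the empty maximum is 0, and [high 0] rightly imposes no condition. *)
Definition maxvar u := \max_(k < n | 0 < u k) k.

Lemma high_maxvarP u v :
  reflect (forall j k : 'I_n, 0 < u j -> 0 < v k -> j <= k) (high (maxvar u) v).
Proof.
apply: (iffP (highP _ _)) => [vP j k uj vk|uv k].
  rewrite leqNgt; apply/negP => kj; move: vk; rewrite vP //.
  by rewrite (leq_trans kj) // /maxvar (bigD1 j) //= leq_maxl.
apply: contraTeq; rewrite -lt0n -leqNgt => vk; apply/bigmax_leqP => j uj.
exact: uv.
Qed.

Lemma mingen_eq I u u' : upset I -> mingen I u -> mingen I u' ->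
  (u <= u')%MM -> u = u'.
Proof.
move=> upI /andP[Iu _] /andP[_ /forallP minu'] le_uu'.
apply: contrapT => /eqP ne_uu'.
have [k ltk] : exists k, u k < u' k.
  apply: contrapT => nex; case/eqP: ne_uu'; apply/mnmP => k; apply/eqP.
  by rewrite eqn_leq (mnm_lepP le_uu') leqNgt; apply/negP => ?; apply: nex; exists k.
have /negP[] := implyP (minu' k) (leq_ltn_trans (leq0n _) ltk).
have -> : (u' - U_(k) = u + (u' - U_(k) - u))%MM.
  rewrite addmC submK //; apply/mnm_lepP => l; rewrite !mnmE.
  by have := mnm_lepP le_uu' l; case: eqP => [<-|_]; lia.
exact: upI.
Qed.

(** Distinct minimal generators do not divide each other: u exceeds u' at some x_j, and u' exceeds u
    at some x_k. Then x_j divides v' and x_k divides v, and sortedness gives both j <= k and k <= j,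
    so j = k, which is absurd. *)
Lemma sorted_factor_inj I u v u' v' : upset I -> mingen I u -> mingen I u' ->
    high (maxvar u) v -> high (maxvar u') v' -> (u + v = u' + v')%MM ->
  u = u' /\ v = v'.
Proof.
move=> upI gu gu' /high_maxvarP uv /high_maxvarP uv' eq_m.
have Em l : u l + v l = u' l + v' l by rewrite -!mnmDE eq_m.
suff euu' : u = u' by split=> //; move: eq_m; rewrite euu' => /addmI.
apply: contrapT => ne_uu'.
have ex1 x y : mingen I x -> mingen I y -> x <> y -> exists j, y j < x j.
  move=> gx gy xy; apply: contrapT => nex; apply: xy; apply: (mingen_eq upI gx gy).
  by apply/mnm_lepP => j; rewrite leqNgt; apply/negP => ?; apply: nex; exists j.
have [j uj] := ex1 _ _ gu gu' ne_uu'.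
have [k uk] := ex1 _ _ gu' gu (nesym ne_uu').
have := uv' k j; have := uv j k; have := Em j; have := Em k.
have [/val_inj jk|] : j = k :> nat \/ j <> k :> nat by lia.
  by move: uj uk; rewrite jk; lia.
by lia.
Qed.

(** A rewriting that lowers the weight of [p]: if [p] is not minimal, a variable passes from [p] to
    [q]; an inversion, x_j in [p] and x_k in [q] with k < j, is exchanged. The two stability
    conditions keep the factors in [I] and [O]. *)
Lemma sorted_factor d I O m : mdeg m = d -> upset O ->
    (forall a, a <= d -> sstable a I) -> (forall b, b <= d -> costable b O) ->
    mprod I O m ->
  exists u v, [/\ mingen I u, O v, high (maxvar u) v & m = (u + v)%MM].
Proof.
move=> dm upO sI sO /asboolP[p [q [Ip Oq epq]]].
have [w] := ubnP (mnmwgt p); elim: w => // w IH in p q Ip Oq epq *.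
rewrite ltnS => wp.
have dp : mdeg p <= d by rewrite -dm epq mdegD leq_addr.
have dq : mdeg q <= d by rewrite -dm epq mdegD leq_addl.
have [gp|] := boolP (mingen I p); last first.
  rewrite /mingen Ip /= => /forallPn[k]; rewrite negb_imply negbK => /andP[pk Ipk].
  have le_k : (U_(k) <= p)%MM by rewrite lep1mP -lt0n.
  apply: (IH (p - U_(k))%MM (q + U_(k))%MM) => //; first exact: upO.
    by rewrite epq -{1}(submK le_k) -!addmA [(U_(k) + q)%MM]addmC.
  by move: wp; rewrite -{1}(submK le_k) mnmwgtD mnmwgt1; lia.
have [hq|] := boolP (high (maxvar p) q); first by exists p, q.
move/high_maxvarP=> nh.
have [j [k [pj qk kj]]] : exists j k, [/\ 0 < p j, 0 < q k & k < j].
  apply: contrapT => nex; apply: nh => j k pj qk; rewrite leqNgt; apply/negP => kj.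
  by apply: nex; exists j, k.
have jk : (j == k) = false by rewrite -val_eqE /=; lia.
apply: (IH (mshift 1 j k p) (mshift 1 k j q)).
- exact: (sI _ dp).
- exact: (sO _ dq).
- rewrite epq; apply/mnmP => l; rewrite !(mshiftE, mnmDE).
  have [jl|jl] := eqVneq j l; have [kl|kl] := eqVneq k l; subst; lia.
have le_j : (U_(j) <= p)%MM by rewrite lep1mP -lt0n.
move: wp; rewrite -{1}(submK le_j) /mshift !mulm1n !mnmwgtD !mnmwgt1; lia.
Qed.

Definition factor_pairs d I J : seq 'X_{1..n} :=
  [seq (u + v)%MM |
    u <- [seq x <- [seq bmnm b | b : 'X_{1..n < d.+1} <- enum {: 'X_{1..n < d.+1}}]
         | mingen I x],
    v <- [seq v <- monos (d - mdeg u) | high (maxvar u) v && J v]].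

Lemma factor_pairsP d I J m : reflect
  (exists u v, [/\ mdeg m = d, mingen I u, J v, high (maxvar u) v & m = (u + v)%MM])
  (m \in factor_pairs d I J).
Proof.
apply: (iffP allpairsPdep) => [[u [v [+ + ->]]]|[u [v [dm gu Jv hv em]]]].
  rewrite !mem_filter mem_monos => /andP[gu /mapP[b _ eb]].
  case/andP=> /andP[hv Jv] /eqP dv; exists u, v; split=> //.
  by rewrite mdegD dv eb subnKC // -ltnS bmdeg.
have du : mdeg u < d.+1 by rewrite -dm em mdegD ltnS leq_addr.
exists u, v; split=> //; rewrite mem_filter.
  rewrite gu; apply/mapP; exists (BMultinom du) => //.
  by rewrite mem_enum.
by rewrite hv Jv mem_monos -dm em mdegD addKn /=.
Qed.

Lemma factor_pairs_uniq d I J : upset I -> uniq (factor_pairs d I J).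
Proof.
move=> upI; apply: allpairs_uniq_dep.
- rewrite filter_uniq // map_inj_uniq -?enumT ?enum_uniq // => x y.
  exact: val_inj.
- by move=> u _; rewrite filter_uniq ?monos_uniq.
move=> _ _ /allpairsPdep[u [v [+ + ->]]] /allpairsPdep[u' [v' [+ + ->]]] /=.
rewrite !mem_filter => /andP[gu _] /andP[/andP[hv _] _] /andP[gu' _].
by case/andP=> /andP[hv' _] _ /(sorted_factor_inj upI gu gu' hv hv')[-> ->].
Qed.

(* A strongly stable I times O is the disjoint union over the minimal generators
   u of I of the u * v, v in O supported on variables of index >= maxvar u. *)
Lemma cnt_mprod_mono d I J O : upset I -> upset O ->
    (forall a, a <= d -> sstable a I) -> (forall b, b <= d -> costable b O) ->
    (forall b s, b <= d ->
      cnt b [pred v | high s v && O v] <= cnt b [pred v | high s v && J v]) ->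
  cnt d (mprod I O) <= cnt d (mprod I J).
Proof.
move=> upI upO sI sO leOJ.
have size_pairs P : size (factor_pairs d I P) = \sum_(u <- [seq x <- [seq bmnm b |
    b : 'X_{1..n < d.+1} <- enum {: 'X_{1..n < d.+1}}] | mingen I x])
    cnt (d - mdeg u) [pred v | high (maxvar u) v && P v].
  rewrite size_allpairs_dep sumnE big_map; apply: eq_bigr => u _.
  by rewrite size_filter.
(* Existence of sorted factorizations bounds I O from above by pairs; uniqueness bounds I J from
   below. *)
apply: (@leq_trans (size (factor_pairs d I O))).
  rewrite /cnt -size_filter; apply: uniq_leq_size => [|m].
    by rewrite filter_uniq ?monos_uniq.
  rewrite mem_filter mem_monos => /andP[+ /eqP dm].
  case/(sorted_factor dm upO sI sO) => u [v [gu Ov hv em]].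
  by apply/factor_pairsP; exists u, v.
apply: (@leq_trans (size (factor_pairs d I J))).
  by rewrite !size_pairs leq_sum // => u _; apply: leOJ; exact: leq_subr.
rewrite /cnt -size_filter; apply: uniq_leq_size; first exact: factor_pairs_uniq.
move=> m /factor_pairsP[u [v [dm /andP[Iu _] Jv _ em]]].
rewrite mem_filter mem_monos dm eqxx andbT.
by apply/asboolP; exists u, v.
Qed.

Definition mrev u : 'X_{1..n} := [multinom u (rev_ord i) | i < n].

Lemma mrevE u i : mrev u i = u (rev_ord i). Proof. exact: mnmE. Qed.

Lemma mrevK : involutive mrev.
Proof. by move=> u; apply/mnmP => i; rewrite !mrevE rev_ordK. Qed.

Lemma mrevD u v : mrev (u + v) = (mrev u + mrev v)%MM.
Proof. by apply/mnmP => i; rewrite !(mrevE, mnmDE). Qed.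

Lemma mdeg_mrev u : mdeg (mrev u) = mdeg u.
Proof.
rewrite !mdegE [RHS](reindex_inj rev_ord_inj) /=.
by apply: eq_bigr => i _; rewrite mrevE.
Qed.

Lemma mshift_mrev k i j u :
  mrev (mshift k i j u) = mshift k (rev_ord i) (rev_ord j) (mrev u).
Proof.
apply/mnmP => l; rewrite !(mrevE, mshiftE).
by rewrite !(can2_eq rev_ordK rev_ordK).
Qed.

Lemma cnt_mrev a P : cnt a (P \o mrev) = cnt a P.
Proof.
apply/eqP; rewrite eqn_leq; apply/andP; split; apply: (cnt_inj (f := mrev)).
- by move=> u du Pu; rewrite mdeg_mrev.
- by move=> u v _ _ _ _ /(can_inj mrevK).
- by move=> u du Pu; rewrite mdeg_mrev /= mrevK.
- by move=> u v _ _ _ _ /(can_inj mrevK).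
Qed.

Lemma high_mrev s u : high s (mrev u) = low (n - s) u.
Proof.
apply/highP/lowP => uP j js.
  by rewrite -(rev_ordK j) -mrevE uP //=; have := ltn_ord j; lia.
by rewrite mrevE uP //=; have := ltn_ord j; lia.
Qed.

(** Reversing the variables while exchanging the factors turns a statement on the right factor into
    one on the left factor. *)
Lemma mprod_mrev I J : mprod I J \o mrev =1 mprod (J \o mrev) (I \o mrev).
Proof.
move=> m; apply/asboolP/asboolP => -[u [v [Iu Jv em]]].
  exists (mrev v), (mrev u); rewrite /= !mrevK; split=> //.
  by rewrite addmC -mrevD -em mrevK.
by exists (mrev v), (mrev u); rewrite em mrevD addmC.
Qed.

Lemma upset_mrev I : upset I -> upset (I \o mrev).
Proof. by move=> upI u m Iu; rewrite /= mrevD; apply: upI. Qed.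

Lemma lexseg_sstable a L : lexseg n a L -> sstable a L.
Proof.
move=> lL u j i du Lu ji ui.
by apply: (lL u); rewrite ?low_size ?mdeg_mshift ?mshift_ltmc.
Qed.

Lemma sstable_mrev a V : sstable a V -> costable a (V \o mrev).
Proof.
move=> sV u i j du Vu ij ui; rewrite /= mshift_mrev; apply: sV => //.
- by rewrite mdeg_mrev.
- by rewrite /=; have := ltn_ord i; have := ltn_ord j; lia.
- by rewrite mrevE rev_ordK.
Qed.

Lemma cnt_high_lexseg a V L s : sstable a V -> lexseg n a L ->
    cnt a L <= cnt a V ->
  cnt a [pred u | high s u && L (mrev u)] <= cnt a [pred u | high s u && V (mrev u)].
Proof.
move=> sV lL leLV; have E P : cnt a [pred u | high s u && P (mrev u)]
    = cnt a [pred u | low (n - s) u && P u].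
  by rewrite -cnt_mrev; apply: eq_cnt => u _ /=; rewrite mrevK high_mrev.
by rewrite !E; apply: cnt_low_lexseg.
Qed.

(** The factor kept fixed has to be strongly stable on the left. It is [L] while [J] and [O] are
    compared, a lex segment being strongly stable, and then [J], brought to the left by reversal,
    while [I] and [L] are compared. *)
Lemma cnt_mprod_lexseg d I J L O :
    upset I -> upset J -> upset L -> upset O ->
    (forall a, a <= d -> [/\ sstable a I, lexseg n a L & cnt a L <= cnt a I]) ->
    (forall a, a <= d -> [/\ sstable a J, lexseg n a O & cnt a O <= cnt a J]) ->
  cnt d (mprod L (O \o mrev)) <= cnt d (mprod I (J \o mrev)).
Proof.
move=> upI upJ upL upO HI HJ.
have sL a : a <= d -> sstable a L by case/HI => _ /lexseg_sstable.
have sO a : a <= d -> sstable a O by case/HJ => _ /lexseg_sstable.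
apply: (@leq_trans (cnt d (mprod L (J \o mrev)))).
  apply: cnt_mprod_mono => //; first exact: upset_mrev.
    by move=> b /sO; exact: sstable_mrev.
  by move=> b s /HJ[sJ lO leOJ]; apply: cnt_high_lexseg.
have E P : cnt d (mprod P (J \o mrev)) = cnt d (mprod J (P \o mrev)).
  rewrite -cnt_mrev; apply: eq_cnt => u _; rewrite mprod_mrev.
  by congr (mprod _ _ _); apply/funext => m /=; rewrite mrevK.
rewrite !E; apply: cnt_mprod_mono => //; first exact: upset_mrev.
- by move=> a /HJ[].
- by move=> b /sL; exact: sstable_mrev.
- by move=> b s /HI[sI lL leLI]; apply: cnt_high_lexseg.
Qed.

End ProductCount.

Local Open Scope classical_set_scope.
Local Open Scope ring_scope.

(** * Coordinate changes and leading monomials *)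

(** Over a domain because it is applied both to [K] and to the polynomials in the entries of a
    matrix. Zero columns pad M to a square matrix of determinant 0. *)
Lemma left_kernel_neq0 (R : idomainType) r t (M : 'M[R]_(r, t)) :
  (t < r)%N -> exists2 v : 'rV[R]_r, v != 0 & v *m M = 0.
Proof.
case: r M => // r M; rewrite ltnS => tr.
pose N : 'M[R]_r.+1 :=
  \matrix_(i, j) (if insub (val j) is Some k then M i k else 0).
have /det0P[v v0 vN] : \det N == 0.
  rewrite (expand_det_col _ ord_max) big1 // => i _; rewrite mxE insubN ?mul0r //=.
  by rewrite -leqNgt.
exists v => //; apply/rowP => j; rewrite !mxE.
have lt_j : (j < r.+1)%N by rewrite ltnS (leq_trans (ltnW (ltn_ord j))).
have := congr1 (fun w : 'rV_r.+1 => w 0 (Ordinal lt_j)) vN; rewrite !mxE => e.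
rewrite -[RHS]e; apply: eq_bigr => i _.
by rewrite mxE /= insubT //= => lt_j'; congr (_ * M _ _); apply: val_inj.
Qed.

Section CoordChange.
Context {K : fieldType} {n : nat}.
Local Notation S := {mpoly K[n]}.
Implicit Types (g h : 'M[K]_n) (p q : S) (I : set S).

Lemma ccD h : {morph coord_change h : p q / p + q}.
Proof. exact: comp_mpolyD. Qed.
Lemma ccZ h c p : coord_change h (c *: p) = c *: coord_change h p.
Proof. exact: comp_mpolyZ. Qed.
Lemma cc0 h : coord_change h 0 = 0.
Proof. exact: comp_mpoly0. Qed.
Lemma ccM h : {morph coord_change h : p q / p * q}.
Proof. by move=> p q; rewrite /coord_change rmorphM. Qed.
Lemma ccC h c : coord_change h c%:MP = c%:MP.
Proof. exact: comp_mpolyC. Qed.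
Lemma cc_sum h T (r : seq T) P (F : T -> S) :
  coord_change h (\sum_(x <- r | P x) F x) = \sum_(x <- r | P x) coord_change h (F x).
Proof. by rewrite /coord_change raddf_sum. Qed.
Lemma ccXE h m : coord_change h 'X_[m] =
  \prod_(i < n) (\sum_(j < n) h j i *: 'X_j) ^+ m i.
Proof.
by rewrite /coord_change comp_mpolyX; apply: eq_bigr => i _; rewrite tnth_mktuple.
Qed.
Lemma ccX h i : coord_change h 'X_i = \sum_(j < n) h j i *: 'X_j.
Proof.
rewrite ccXE (bigD1 i) //= [X in _ * X]big1 ?mulr1 ?mnm1E ?eqxx ?expr1 // => j ji.
by rewrite mnm1E eq_sym (negbTE ji).
Qed.
Lemma ccXn h p k : coord_change h (p ^+ k) = coord_change h p ^+ k.
Proof. by rewrite /coord_change rmorphXn. Qed.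

Lemma cc_prod h T (r : seq T) P (F : T -> S) :
  coord_change h (\prod_(x <- r | P x) F x) = \prod_(x <- r | P x) coord_change h (F x).
Proof. by rewrite /coord_change rmorph_prod. Qed.

Lemma cc_comp g h p : coord_change g (coord_change h p) = coord_change (g *m h) p.
Proof.
rewrite [p]mpolyE (cc_sum h) (cc_sum g) (cc_sum (g *m h)); apply: eq_bigr => m _.
rewrite !ccZ; congr (_ *: _).
rewrite !ccXE cc_prod. apply: eq_bigr => i _.
rewrite ccXn; congr (_ ^+ _); rewrite cc_sum.
rewrite (eq_bigr (fun j => \sum_k (g k j * h j i) *: 'X_k)) => [|j _].
  rewrite exchange_big /=; apply: eq_bigr => k _; rewrite -scaler_suml.
  by congr (_ *: _); rewrite mxE.
rewrite ccZ ccX scaler_sumr; apply: eq_bigr => k _.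
by rewrite scalerA mulrC.
Qed.

Lemma cc1 p : coord_change 1%:M p = p.
Proof.
rewrite [RHS]mpolyE {1}[p]mpolyE cc_sum; apply: eq_bigr => m _; rewrite ccZ ccXE.
rewrite [in RHS]mpolyXE_id; congr (_ *: _); apply: eq_bigr => i _; congr (_ ^+ _).
rewrite (bigD1 i) //= mxE eqxx scale1r big1 ?addr0 // => j ji.
by rewrite mxE (negbTE ji) scale0r.
Qed.

Lemma ccK h : h \in unitmx -> cancel (coord_change h) (coord_change (invmx h)).
Proof. by move=> uh p; rewrite cc_comp mulVmx // cc1. Qed.

Lemma ccVK h : h \in unitmx -> cancel (coord_change (invmx h)) (coord_change h).
Proof. by move=> uh p; rewrite cc_comp mulmxV // cc1. Qed.

Lemma cc_homog h d p : p \is d.-homog -> coord_change h p \is d.-homog.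
Proof.
move=> /dhomogP hp; rewrite [p]mpolyE cc_sum big_seq.
apply: rpred_sum => m /hp /= <-; rewrite ccZ rpredZ // ccXE mdegE.
elim/big_ind2: _ => [|x a y b hx hy|i _]; first exact: dhomog1.
  exact: dhomogM.
suff /(dhomogMn (m i)) : \sum_(j < n) h j i *: 'X_j \is 1.-homog by rewrite mul1n.
by apply: rpred_sum => j _; rewrite rpredZ // dhomogX /= mdeg1.
Qed.

Lemma pihomog_cc h d p :
  pihomog mdeg d (coord_change h p) = coord_change h (pihomog mdeg d p).
Proof.
rewrite {1}(pihomog_partitionE (leq_addr d.+1 (msize p)) ) cc_sum raddf_sum /=.
have lt_d : (d < msize p + d.+1)%N by lia.
rewrite (bigD1 (Ordinal lt_d)) //= big1 ?addr0 => [|e ne].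
  by rewrite pihomog_dE // cc_homog // pihomogP.
rewrite (@pihomog_ne0 _ _ _ e) ?cc_homog ?pihomogP //.
Qed.

Lemma ideal_sum I T (r : seq T) (P : pred T) (F : T -> S) : is_ideal I ->
  (forall x, P x -> I (F x)) -> I (\sum_(x <- r | P x) F x).
Proof. by case=> I0 ID _ IF; elim/big_ind: _. Qed.

Lemma idealZ I c p : is_ideal I -> I p -> I (c *: p).
Proof. by case=> _ _ IM Ip; rewrite -mul_mpolyC; apply: IM. Qed.

Lemma cc_ideal h I : h \in unitmx -> is_homogeneous_ideal I ->
  is_homogeneous_ideal (coord_change h @` I).
Proof.
move=> uh [[I0 ID IM] Ih]; split; last first.
  by move=> _ d [p Ip <-]; exists (pihomog mdeg d p); rewrite ?pihomog_cc //; apply: Ih.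
split; first by exists 0; rewrite ?cc0.
  by move=> _ _ [p Ip <-] [q Iq <-]; exists (p + q); rewrite ?ccD //; apply: ID.
move=> a _ [p Ip <-]; exists (coord_change (invmx h) a * p); first exact: IM.
by rewrite ccM ccVK.
Qed.

Lemma ideal_gen_ideal (A : set S) : is_ideal (ideal_gen A).
Proof.
split; first by exists [::]; rewrite big_nil.
  move=> _ _ [s [hs ->]] [t [ht ->]]; exists (s ++ t); rewrite big_cat; split=> //.
  by move=> x; rewrite mem_cat => /orP[/hs|/ht].
move=> a _ [s [hs ->]]; exists [seq (a * x.1, x.2) | x <- s]; split.
  by move=> _ /mapP[x /hs ? ->].
by rewrite mulr_sumr big_map; apply: eq_bigr => x _; rewrite mulrA.
Qed.

Lemma ideal_mul_ideal I J : is_ideal (ideal_mul I J).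
Proof. exact: ideal_gen_ideal. Qed.

Lemma ideal_mulM I J p q : I p -> J q -> ideal_mul I J (p * q).
Proof.
move=> Ip Jq; exists [:: (1, p * q)]; rewrite big_seq1 mul1r; split=> // x.
by rewrite inE => /eqP ->; exists p => //; exists q.
Qed.

End CoordChange.

Section LeadingMonomials.
Context {K : fieldType} {n : nat}.
Local Notation S := {mpoly K[n]}.
Implicit Types (p q : S) (I A : set S) (m : 'X_{1..n}).

Definition lfree r (p : 'I_r -> S) :=
  forall c : 'I_r -> K, \sum_i c i *: p i = 0 -> forall i, c i = 0.

(* The order on monomials, called degrevlex in mpoly.v, compares degrees and then
   exponents lexicographically: on forms it is lex, the first variable being largest. *)
Definition is_lead p m :=
  [/\ p \is (mdeg m).-homog, p@_m = 1 & forall m', (m < m')%O -> p@_m' = 0].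

Definition hlead A : pred 'X_{1..n} := fun m => `[< exists2 p, A p & is_lead p m >].

Lemma hlead_upset I : is_ideal I -> upset (hlead I).
Proof.
move=> [_ _ IM] m k /asboolP[p Ip [hp pm gtm]]; apply/asboolP.
exists ('X_[k] * p); first exact: IM.
have coefE m' : ('X_[k] * p)@_m' = if (k <= m')%MM then p@_(m' - k) else 0.
  rewrite mulrC; case: ifPn => [km'|nkm'].
    by rewrite -{1}(submK km') addmC mcoeffMX.
  apply: memN_msupp_eq0; rewrite (perm_mem (msuppMX _ _)).
  by apply: contra nkm' => /mapP[m1 _ ->]; apply: lem_addr.
split; first by rewrite mdegD addnC dhomogM // dhomogX.
  by rewrite coefE lem_addl addmK.
move=> m' mm'; rewrite coefE; case: ifP => // km'; apply: gtm.
by rewrite -(ltmc_add2l _ _ k) submK.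
Qed.

Lemma homog_lead d p : p != 0 -> p \is d.-homog ->
  mdeg (mlead p) = d /\ is_lead ((p@_(mlead p))^-1 *: p) (mlead p).
Proof.
move=> p0 hp; have dl : mdeg (mlead p) = d.
  by apply: (dhomog_mf hp); apply: mlead_supp.
split=> //; split; first by rewrite dl rpredZ.
  by rewrite mcoeffZ mulVf // mleadc_eq0.
by move=> m' ltm; rewrite mcoeffZ (mcoeff_gt_mlead ltm) mulr0.
Qed.

(** With more forms than leading monomials, a nonzero combination would have coefficient 0 at every
    leading monomial of degree [d], its own included. *)
Lemma lfree_cnt_hlead I d r (p : 'I_r -> S) : is_ideal I ->
    (forall i, I (p i) /\ p i \is d.-homog) -> lfree p ->
  (r <= cnt d (hlead I))%N.
Proof.
move=> idI hp frp; rewrite leqNgt; apply/negP; rewrite /cnt -size_filter.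
set s := filter _ _ => lt_r.
have [v v0 vM] := @left_kernel_neq0 K r (size s)
  (\matrix_(i, j) (p i)@_(nth 0%MM s j)) lt_r.
pose q := \sum_i v 0 i *: p i.
have q0 : q != 0.
  apply: contra_neq v0 => /frp v0; apply/rowP => i; rewrite mxE; exact: v0.
have Iq : I q by apply: ideal_sum => // i _; apply: idealZ => //; case: (hp i).
have hq : q \is d.-homog by apply: rpred_sum => i _; rewrite rpredZ //; case: (hp i).
have [dl ldq] := homog_lead q0 hq.
have ls : mlead q \in s.
  rewrite mem_filter mem_monos dl eqxx andbT; apply/asboolP.
  by exists ((q@_(mlead q))^-1 *: q) => //; apply: idealZ.
have lt_j : (index (mlead q) s < size s)%N by rewrite index_mem.
have := congr1 (fun w : 'rV_(size s) => w 0 (Ordinal lt_j)) vM; rewrite !mxE /=.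
under eq_bigr do rewrite mxE /= nth_index //.
move=> e; move: q0; rewrite -mleadc_eq0 {1}/q raddf_sum /=.
by under eq_bigr do rewrite mcoeffZ; rewrite e eqxx.
Qed.

Lemma lead_lfree r (p : 'I_r -> S) (m : 'I_r -> 'X_{1..n}) :
  injective m -> (forall i, is_lead (p i) (m i)) -> lfree p.
Proof.
move=> m_inj pm c sum0 i; apply: contrapT => /eqP ci.
have [j cj jmax] := @arg_maxP _ _ _ i (fun j => c j != 0) m ci.
have := congr1 (mcoeff (m j)) sum0; rewrite raddf_sum /= (bigD1 j) //=.
rewrite big1 ?addr0 => [|k kj].
  by rewrite mcoeffZ mcoeff0; have [_ -> _] := pm j; rewrite mulr1; apply/eqP.
rewrite mcoeffZ; have [->|ck] := eqVneq (c k) 0; first by rewrite mul0r.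
have [_ _ ->] := pm k; first by rewrite mulr0.
by rewrite lt_def [(_ <= _)%O]jmax // andbT; apply: contra_neq kj => /m_inj.
Qed.

Lemma cnt_hlead_lfree A d : exists r (p : 'I_r -> S),
  [/\ r = cnt d (hlead A), lfree p & forall i, A (p i) /\ p i \is d.-homog].
Proof.
pose s := [seq m <- monos d | hlead A m].
have sP (i : 'I_(size s)) : exists p, A p /\ is_lead p (nth 0%MM s i).
  have : nth 0%MM s i \in s by rewrite mem_nth.
  by rewrite mem_filter => /andP[/asboolP[p Ap lp] _]; exists p.
have [p pP] := choice sP; exists (size s), p; split.
- by rewrite size_filter.
- apply: (@lead_lfree _ _ (fun i => nth 0%MM s i)) => [i j /eqP|i]; last first.
    by case: (pP i).
  by rewrite nth_uniq ?filter_uniq ?monos_uniq // => /eqP /val_inj.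
move=> i; have [Ap [hp _ _]] := pP i; split=> //; move: hp.
suff -> : mdeg (nth 0%MM s i) = d by [].
apply/eqP; rewrite -mem_monos.
by have := mem_nth 0%MM (ltn_ord i); rewrite mem_filter => /andP[].
Qed.

Lemma lfree_cc r (p : 'I_r -> S) h : h \in unitmx ->
  lfree p -> lfree (fun i => coord_change h (p i)).
Proof.
move=> uh frp c; under eq_bigr do rewrite -ccZ.
rewrite -cc_sum => /(congr1 (coord_change (invmx h))).
by rewrite ccK // cc0; apply: frp.
Qed.

End LeadingMonomials.

(** * Hilbert functions count leading monomials *)

Section HilbertFunction.
Context {K : fieldType} {n : nat}.
Local Notation S := {mpoly K[n.+1]}.
Implicit Types (I : set S).

Lemma hilbert_lfree I d : is_ideal I -> exists p : 'I_(hilbert I d) -> S,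
  lfree p /\ forall i, I (p i) /\ p i \is d.-homog.
Proof.
move=> idI; pose b := vbasis (homog_part I d).
exists (fun i => val b`_i); split=> [c|i].
  move=> sum0; have /freeP frb := basis_free (vbasisP (homog_part I d)).
  apply: frb; apply: val_inj; rewrite /= -[RHS]sum0 raddf_sum /=.
  by apply: eq_bigr => i _.
split; last by case: (b`_i).
by apply/(homog_partP _ idI)/vbasis_mem/mem_nth; rewrite size_tuple.
Qed.

Lemma lfree_hilbert I d r (p : 'I_r -> S) : is_ideal I -> lfree p ->
  (forall i, I (p i) /\ p i \is d.-homog) -> (r <= hilbert I d)%N.
Proof.
move=> idI frp hp.
pose X := [tuple DHomog (proj2 (hp i)) | i < r].
have XE (i : 'I_r) : X`_i = DHomog (proj2 (hp i)).
  by rewrite -tnth_nth tnth_mktuple.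
have frX : free X.
  apply/freeP => c /(congr1 val) sum0; apply: frp; rewrite -[RHS]sum0 /= raddf_sum /=.
  by apply: eq_bigr => i _; rewrite XE.
rewrite -(size_tuple X) -(eqP frX); apply/dimvS/span_subvP => x /(nthP 0)[i].
rewrite size_tuple => ir <-; rewrite (XE (Ordinal ir)).
by apply/(homog_partP _ idI); case: (hp (Ordinal ir)).
Qed.

Lemma hilbert_cnt_hlead I d : is_ideal I -> hilbert I d = cnt d (hlead I).
Proof.
move=> idI; apply/eqP; rewrite eqn_leq; apply/andP; split.
  by have [p [frp hp]] := hilbert_lfree d idI; apply: (lfree_cnt_hlead idI hp frp).
have [r [p [<- frp hp]]] := cnt_hlead_lfree I d.
exact: lfree_hilbert frp hp.
Qed.

End HilbertFunction.

(** * Degenerations *)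

Section Weight.
Context {n : nat}.
Implicit Types (m : 'X_{1..n}).

(** The exponents as digits in base [B], the first variable most significant: an integer weight that
    induces the order on monomials of equal degree below [B]. *)
Definition wt B m := (\sum_(k < n) m k * B ^ (n - k))%N.

Lemma wt_lt B m m' (i : 'I_n) : (mdeg m' < B)%N ->
  (forall j : 'I_n, (j < i)%N -> m' j = m j) -> (m' i < m i)%N -> (wt B m' < wt B m)%N.
Proof.
move=> dm' eq_lt lt_i.
have tail : (\sum_(k < n | (i < k)%N) m' k * B ^ (n - k) < B ^ (n - i))%N.
  apply: (@leq_ltn_trans (mdeg m' * B ^ (n - i.+1))%N).
    rewrite mdegE big_distrl /= big_mkcond; apply: leq_sum => k _.
    by case: ifP => // ik; rewrite leq_mul2l leq_pexp2l ?orbT //; lia.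
  have -> : (n - i = (n - i.+1).+1)%N by have := ltn_ord i; lia.
  by rewrite expnS ltn_mul2r dm' expn_gt0; case: (B) dm'.
rewrite /wt (bigID (fun k : 'I_n => (k < i)%N)) [X in (_ < X)%N](bigID (fun k : 'I_n => (k < i)%N)) /=.
rewrite (eq_bigr (fun k => m k * B ^ (n - k))%N) => [|k /eq_lt -> //].
rewrite ltn_add2l (bigD1 i) ?ltnn // [X in (_ < X)%N](bigD1 i) ?ltnn //=.
rewrite (eq_bigl (fun k : 'I_n => (i < k)%N)) => [|k]; last first.
  by rewrite -leqNgt ltn_neqAle andbC eq_sym.
apply: leq_trans (leq_addr _ _).
apply: (@leq_trans ((m' i).+1 * B ^ (n - i))%N); last by rewrite leq_mul2r lt_i orbT.
by rewrite mulSn addnC ltn_add2r.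
Qed.

Lemma wt_ltmc B m m' : mdeg m' = mdeg m -> (mdeg m < B)%N -> (m' < m)%O ->
  (wt B m' < wt B m)%N.
Proof. by move=> dm mB /(ltmcP dm)[i eqi lti]; apply: wt_lt lti; rewrite ?dm. Qed.

Lemma wt_inj B m m' : (mdeg m < B)%N -> (mdeg m' < B)%N -> wt B m = wt B m' -> m = m'.
Proof.
move=> mB m'B ewt; apply: contrapT => ne_m.
have exi : exists i, m i != m' i.
  apply: contrapT => nex; apply: ne_m; apply/mnmP => i; apply/eqP.
  by apply: contrapT => /negP ?; apply: nex; exists i.
have [i0 ne0] := exi; case: (@arg_minnP _ i0 (fun i => m i != m' i) val ne0) => i ne_i mini.
have eq_lt (j : 'I_n) : (j < i)%N -> m j = m' j.
  by move=> ji; apply/eqP; apply: contraLR ji => /mini; rewrite -leqNgt.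
case: (ltngtP (m i) (m' i)) ne_i => // lt_i _.
  by have := wt_lt mB eq_lt lt_i; rewrite ewt ltnn.
have := wt_lt m'B (fun j ji => esym (eq_lt j ji)) lt_i.
by rewrite ewt ltnn.
Qed.

End Weight.

Section CharZero.
Context {K : fieldType} (charK : [pchar K] =i pred0).

Lemma natr_inj : injective (fun k : nat => k%:R : K).
Proof.
have H := (pcharf0P K).1 charK.
have W k l : (k <= l)%N -> k%:R = l%:R :> K -> k = l.
  move=> kl /eqP; rewrite eq_sym -subr_eq0 -natrB // H => ?; lia.
by move=> k l ekl; case: (leqP k l) => [|/ltnW] /W h; [exact: h | exact/esym/h/esym].
Qed.

Lemma poly_nonroot (f : {poly K}) : f != 0 -> exists2 t, t != 0 & f.[t] != 0.
Proof.
(* The factor ['X] rules out t = 0, at which the curves below give the limit and not a change of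
   coordinates. *)
move=> f0; have fX0 : f * 'X != 0 by rewrite mulf_neq0 // polyX_eq0.
pose rs := [seq k%:R : K | k <- iota 0 (size (f * 'X))].
have /allPn[t _] : ~~ all (root (f * 'X)) rs.
  apply/negP => /(max_poly_roots fX0); rewrite map_inj_uniq ?iota_uniq; last exact: natr_inj.
  by rewrite size_map size_iota ltnn => /(_ isT).
rewrite rootE hornerM hornerX mulf_eq0 negb_or => /andP[ft t0].
by exists t.
Qed.

End CharZero.

Section Degeneration.
Context {K : fieldType} (charK : [pchar K] =i pred0) {n : nat}.
Local Notation S := {mpoly K[n]}.
Implicit Types (p q : S) (I : set S) (V : pred 'X_{1..n}) (m : 'X_{1..n}) (g h : 'M[K]_n).

Definition mspan V : set S := [set p | forall m, m \in msupp p -> V m].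

Lemma mspan_ideal V : upset V -> is_homogeneous_ideal (mspan V).
Proof.
move=> upV; split; last first.
  move=> p d Vp m mp; apply: Vp; rewrite pihomogE in mp.
  have := msupp_sum_le mp; case/flattenP => s /mapP[m' + ->].
  by rewrite mem_filter => /andP[_ m'p] /msuppZ_le; rewrite msuppX mem_seq1 => /eqP ->.
split=> [m|p q Vp Vq m|a p Vp m]; first by rewrite msupp0.
  by move/msuppD_le; rewrite mem_cat => /orP[/Vp|/Vq].
move/msuppM_le/allpairsP => [[m1 m2] [/= _ /Vp Vm ->]].
by rewrite addmC; apply: upV.
Qed.

Lemma mspanX V m : V m -> mspan V 'X_[m].
Proof. by move=> Vm m'; rewrite msuppX mem_seq1 => /eqP ->. Qed.

(** Polynomial along polynomial curves: enough to pass from t = 0, where F does not vanish, to some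
    t != 0 with the same property. *)
Definition polylike r (F : ('I_r -> S) -> K) := forall P : 'I_r -> {poly S},
  exists f : {poly K}, forall t, F (fun k => (P k).[t%:MP]) = f.[t].

(* I' is a limit of ideals g(I): a polynomial inequation F <> 0 satisfied by forms
   of I' is also satisfied by forms of the same degrees in some g(I). *)
Definition degenerates I I' := forall r (d : 'I_r -> nat) (p : 'I_r -> S) F,
  polylike F -> (forall k, I' (p k) /\ p k \is (d k).-homog) -> F p != 0 ->
  exists g (p' : 'I_r -> S), [/\ g \in unitmx, forall k, I (p' k) /\ p' k \is (d k).-homog
    & F (fun k => coord_change g (p' k)) != 0].

Lemma degenerates_refl I : degenerates I I.
Proof.
move=> r d p F _ Ip Fp; exists 1%:M, p; split=> //; first exact: unitmx1.
by have -> : (fun k => coord_change 1%:M (p k)) = p by apply/funext => k; rewrite cc1.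
Qed.

Lemma polylike_cc r (F : ('I_r -> S) -> K) g : polylike F ->
  polylike (fun p : 'I_r -> S => F (fun k => coord_change g (p k))).
Proof.
move=> Fpoly P; have [f fP] := Fpoly (fun k => map_poly (coord_change g) (P k)).
exists f => t; rewrite -fP; congr F; apply/funext => k.
have morph : (map_poly (coord_change g) (P k)).[coord_change g t%:MP]
    = coord_change g (P k).[t%:MP].
  exact: horner_map.
by rewrite -morph ccC.
Qed.

Lemma cc_diag (d : 'rV[K]_n) m :
  coord_change (diag_mx d) 'X_[m] = (\prod_k d 0 k ^+ m k) *: 'X_[m].
Proof.
rewrite ccXE [in RHS]mpolyXE_id -scaler_prod; apply: eq_bigr => i _.
rewrite -exprZn; congr (_ ^+ _); rewrite (bigD1 i) //= mxE eqxx mulr1n big1 ?addr0 //.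
by move=> j ji; rewrite mxE (negbTE ji) scale0r.
Qed.

Definition wt_diag B (t : K) : 'M[K]_n := diag_mx (\row_k t^-1 ^+ (B ^ (n - k))).

Lemma wt_diag_unit B t : t != 0 -> wt_diag B t \in unitmx.
Proof.
move=> t0; rewrite unitmxE det_diag unitfE prodf_seq_neq0; apply/allP => k _.
by rewrite mxE expf_neq0 // invr_neq0.
Qed.

Lemma cc_wt_diag B t m : coord_change (wt_diag B t) 'X_[m] = t^-1 ^+ wt B m *: 'X_[m].
Proof.
rewrite cc_diag /wt; congr (_ *: _); elim/big_rec2: _ => [|i y1 y2 _ ->].
  by rewrite expr0.
by rewrite mxE -exprM exprD mulnC.
Qed.

(** The curve from [q] to its leading monomial [m]: t^(wt m) times the image of [q] under
    [wt_diag B t], written without negative powers so that t = 0 is allowed. *)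
Definition lead_curve B q m : {poly S} :=
  \sum_(m' <- msupp q) (q@_m' *: 'X_[m'])%:P * 'X^(wt B m - wt B m').

Lemma lead_curveE B q m t : (lead_curve B q m).[t%:MP] =
  \sum_(m' <- msupp q) (t ^+ (wt B m - wt B m') * q@_m') *: 'X_[m'].
Proof.
rewrite horner_sum; apply: eq_bigr => m' _.
rewrite hornerM hornerC hornerXn -rmorphXn /= mulrC mul_mpolyC scalerA.
by [].
Qed.

Lemma lead_le q m m' : is_lead q m -> m' \in msupp q ->
  mdeg m' = mdeg m /\ (m' <= m)%O.
Proof.
move=> [hq _ gtm] m'q; split; first by have /= := dhomog_mf hq m'q.
rewrite leNgt; apply/negP => /gtm /eqP; apply/negP.
by rewrite -mcoeff_msupp.
Qed.

Lemma lead_curve0 B q m : is_lead q m -> (mdeg m < B)%N ->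
  (lead_curve B q m).[(0 : K)%:MP] = 'X_[m].
Proof.
move=> lq mB; have [hq qm gtm] := lq; rewrite lead_curveE.
have mq : m \in msupp q by rewrite mcoeff_msupp qm oner_neq0.
rewrite (bigD1_seq m) ?msupp_uniq //= subnn expr0 mul1r qm scale1r.
rewrite big_seq_cond big1 ?addr0 // => m' /andP[/(lead_le lq)[dm' le_m'] ne].
have lt_m' : (m' < m)%O by rewrite lt_def eq_sym ne.
have lt_wt := wt_ltmc dm' mB lt_m'.
by rewrite expr0n subn_eq0 leqNgt lt_wt mul0r scale0r.
Qed.

Lemma lead_curve_neq0 B q m t : is_lead q m -> (mdeg m < B)%N -> t != 0 ->
  (lead_curve B q m).[t%:MP] = t ^+ wt B m *: coord_change (wt_diag B t) q.
Proof.
move=> lq mB t0; rewrite lead_curveE {3}[q]mpolyE cc_sum scaler_sumr.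
rewrite big_seq [RHS]big_seq; apply: eq_bigr => m' /(lead_le lq)[dm' le_m'].
have le_wt : (wt B m' <= wt B m)%N.
  move: le_m'; rewrite le_eqVlt => /predU1P[-> //|lt_m']; apply/ltnW.
  exact: wt_ltmc.
rewrite ccZ cc_wt_diag !scalerA; congr (_ *: _).
rewrite [RHS]mulrAC; congr (_ * _).
by rewrite expfB_cond ?exprVn // (negbTE t0) add0n.
Qed.

(** The curves [P k] pass through [p k] at t = 0, and for t != 0 consist of forms of I' moved by
    [wt_diag B t *m h]. A nonroot t of F along them replaces [p] by forms of I'; then [degI],
    applied to F composed with this move, leads on to I. *)
Lemma degenerates_hlead I I' h : degenerates I I' -> h \in unitmx -> is_ideal I' ->
  degenerates I (mspan (hlead (coord_change h @` I'))).
Proof.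
move=> degI uh idI' r d p F Fpoly hp Fp0.
pose V := hlead (coord_change h @` I').
have exq m : exists q, V m -> [/\ I' q, q \is (mdeg m).-homog & is_lead (coord_change h q) m].
  have [Vm|nVm] := boolP (V m); last by exists 0.
  have /asboolP[_ [q Iq <-] lq] := Vm; exists q => _; split=> //.
  have [hq _ _] := lq; rewrite -(ccK uh q); exact: cc_homog.
have [q qP] := choice exq.
(* [B] exceeds all degrees involved, so that one matrix [wt_diag B t] serves all the forms. *)
pose B := (\max_k d k).+1.
have mB k m : m \in msupp (p k) -> (mdeg m < B)%N.
  have [_ hpk] := hp k => /(dhomog_mf hpk) /= ->.
  by rewrite ltnS; apply: (@leq_bigmax _ d k).
pose P k : {poly S} :=
  \sum_(m <- msupp (p k)) ((p k)@_m)%:MP%:P * lead_curve B (coord_change h (q m)) m.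
have PE k t : (P k).[t%:MP] = \sum_(m <- msupp (p k))
    (p k)@_m *: (lead_curve B (coord_change h (q m)) m).[t%:MP].
  by rewrite horner_sum; apply: eq_bigr => m _; rewrite hornerM hornerC mul_mpolyC.
have P0 k : (P k).[(0 : K)%:MP] = p k.
  rewrite PE [RHS]mpolyE big_seq [RHS]big_seq; apply: eq_bigr => m mp.
  have [Vp _] := hp k; have [_ _ lq] := qP m (Vp m mp).
  by rewrite lead_curve0 // (mB k).
have [f fP] := Fpoly P.
have f0 : f != 0.
  apply: contraNneq Fp0 => f0; have := fP 0; rewrite f0 horner0 => <-.
  by apply/eqP; congr F; apply/funext => k; rewrite P0.
have [t t0 ft] := poly_nonroot charK f0.
pose g0 := wt_diag B t *m h.
pose p1 k := \sum_(m <- msupp (p k)) ((p k)@_m * t ^+ wt B m) *: q m.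
have p1E k : coord_change g0 (p1 k) = (P k).[t%:MP].
  rewrite PE /p1 cc_sum big_seq [RHS]big_seq; apply: eq_bigr => m mp.
  have [Vp _] := hp k; have [_ _ lq] := qP m (Vp m mp).
  by rewrite lead_curve_neq0 ?(mB k) // ccZ -cc_comp scalerA.
have hp1 k : I' (p1 k) /\ p1 k \is (d k).-homog.
  have [Vp hpk] := hp k; rewrite /p1 big_seq; split.
    by apply: ideal_sum => // m mp; apply: idealZ => //; case: (qP m (Vp m mp)).
  apply: rpred_sum => m mp; apply: rpredZ; have [_ + _] := qP m (Vp m mp).
  by rewrite (dhomog_mf hpk mp).
have Fp1 : F (fun k => coord_change g0 (p1 k)) != 0.
  suff -> : (fun k => coord_change g0 (p1 k)) = (fun k => (P k).[t%:MP]) by rewrite fP.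
  by apply/funext => k; rewrite p1E.
have [g [p' [ug hp' Fp']]] := degI r d p1 _ (polylike_cc g0 Fpoly) hp1 Fp1.
exists (g0 *m g), p'; split; [|exact: hp'|].
  by rewrite !unitmx_mul wt_diag_unit // uh.
suff -> : (fun k => coord_change (g0 *m g) (p' k)) =
  (fun k => coord_change g0 (coord_change g (p' k))) by [].
by apply/funext => k; rewrite cc_comp.
Qed.

End Degeneration.

(** * Shears and strongly stable limits *)

Section Shear.
Context {K : fieldType} (charK : [pchar K] =i pred0) {n : nat}.
Local Notation S := {mpoly K[n]}.
Implicit Types (V : pred 'X_{1..n}) (m b : 'X_{1..n}) (i j : 'I_n).

Definition shear (c : K) j i : 'M[K]_n := 1%:M + c *: delta_mx j i.

Lemma shearD c c' j i : j != i -> shear c j i *m shear c' j i = shear (c + c') j i.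
Proof.
move=> ji; rewrite /shear mulmxDl mul1mx mulmxDr mulmx1 -scalemxAl -scalemxAr.
by rewrite mul_delta_mx_0 1?eq_sym // !scaler0 addr0 scalerDl -addrA [X in _ + X]addrC.
Qed.

Lemma shear0 j i : shear 0 j i = 1%:M.
Proof. by rewrite /shear scale0r addr0. Qed.

Lemma shear_unit c j i : j != i -> shear c j i \in unitmx.
Proof.
move=> ji; have /mulmx1_unit[] // : shear c j i *m shear (- c) j i = 1%:M.
by rewrite shearD // subrr shear0.
Qed.

Lemma cc_shear c j i k : j != i ->
  coord_change (shear c j i) 'X_k = if k == i then 'X_i + c *: 'X_j else 'X_k :> S.
Proof.
move=> ji; rewrite ccX (eq_bigr (fun l => (l == k)%:R *: 'X_l
    + (c * ((l == j) && (k == i))%:R) *: 'X_l)) => [|l _]; last first.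
  by rewrite !mxE -scalerDl.
rewrite big_split /= (bigD1 k) //= eqxx scale1r big1 ?addr0 => [|l lk]; last first.
  by rewrite (negbTE lk) scale0r.
rewrite (bigD1 j) //= eqxx /= [X in _ + (_ + X)]big1 ?addr0 => [|l lj]; last first.
  by rewrite (negbTE lj) mulr0 scale0r.
by case: eqP => [->|]; rewrite ?mulr1 // mulr0 scale0r addr0.
Qed.

(** For [b] free of x_i and x_j, these are the monomials mixed by the shear x_i -> x_i + c x_j,
    indexed by their exponent in x_i. *)
Definition fiber b j i s q := (b + U_(j) *+ (s - q) + U_(i) *+ q)%MM.

Lemma fiberE b j i s q k : j != i -> b j = 0%N -> b i = 0%N ->
  fiber b j i s q k = if k == j then (s - q)%N else if k == i then q else b k.
Proof.
move=> ji bj bi; rewrite !(mnmE, mulmnE) ![_ == k]eq_sym.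
have [->|kj] := eqVneq k j; first by rewrite bj (negbTE ji); lia.
by have [->|ki] := eqVneq k i; rewrite ?bi; lia.
Qed.

Lemma mdeg_fiber b j i s q : (q <= s)%N -> mdeg (fiber b j i s q) = (mdeg b + s)%N.
Proof. by move=> qs; rewrite !mdegD !mdegMn !mdeg1; lia. Qed.

Lemma cc_shear_fiber c b j i s q : j != i -> b i = 0%N -> (q <= s)%N ->
  coord_change (shear c j i) 'X_[fiber b j i s q] =
  \sum_(l < q.+1) ('C(q, l)%:R * c ^+ (q - l)) *: 'X_[fiber b j i s l] :> S.
Proof.
move=> ji bi qs; rewrite !mpolyXD !ccM -!mpolyXn !ccXn !cc_shear // eqxx (negbTE ji).
have -> : coord_change (shear c j i) 'X_[b] = 'X_[b] :> S.
  rewrite mpolyXE_id cc_prod; apply: eq_bigr => k _; rewrite ccXn cc_shear //.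
  by case: eqP => // ->; rewrite bi !expr0.
rewrite addrC exprDn mulr_sumr; apply: eq_bigr => l _.
have lq : (l <= q)%N by rewrite -ltnS.
rewrite /fiber !mpolyXD -!mpolyXn exprZn -scaler_nat.
have -> : (s - l = (s - q) + (q - l))%N by lia.
rewrite exprD -!mul_mpolyC !mpolyCM rmorphXn /=.
ring.
Qed.

Lemma fiber_lt b j i s q l : (j < i)%N -> b j = 0%N -> b i = 0%N ->
  (q < l <= s)%N -> (fiber b j i s l < fiber b j i s q)%O.
Proof.
move=> lt_ji bj bi /andP[ql ls]; have ji : j != i by rewrite -val_eqE /=; lia.
apply/ltmcP; first by rewrite !mdeg_fiber //; lia.
exists j => [k kj|]; rewrite !fiberE // ?eqxx; last lia.
by rewrite -!val_eqE /= !ltn_eqF //; lia.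
Qed.

(* The shear maps Y_p to the sum of the 'C(p, l) Y_l, l <= p. The terms with l < r
   = m i are killed by subtracting images of elements of V, the coefficient 'C(p, r)
   of m is not 0 in characteristic 0, and the remaining terms are smaller than m. *)
Lemma shear_lead V m (j i : 'I_n) k : (j < i)%N -> (k <= m j)%N ->
    V (mshift k j i m) ->
    (forall l, (0 < l <= m i)%N -> V (mshift l i j m)) ->
  hlead (coord_change (shear 1 j i : 'M[K]_n) @` mspan V) m.
Proof.
move=> lt_ji km Vk Vl; have ji : j != i by rewrite -val_eqE /=; lia.
pose b := [multinom if (l == j) || (l == i) then 0%N else m l | l < n].
have bj : b j = 0%N by rewrite mnmE eqxx.
have bi : b i = 0%N by rewrite mnmE eqxx orbT.
pose r := m i; pose s := (m i + m j)%N; pose Y q := fiber b j i s q.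
pose p := (r + k)%N.
have mshY q m' : m' j = (s - q)%N -> m' i = q ->
    (forall l, l != j -> l != i -> m' l = m l) -> m' = Y q.
  move=> mj mi ml; apply/mnmP => l; rewrite fiberE //.
  have [->|lj] := eqVneq l j; first by [].
  have [->|li] := eqVneq l i; first by [].
  by rewrite ml // mnmE (negbTE lj) (negbTE li).
have Ym : m = Y r by apply: mshY => //; rewrite /s /r; lia.
have ij : (i == j) = false by rewrite eq_sym (negbTE ji).
have VYp : V (Y p).
  rewrite -(mshY p (mshift k j i m)) // => [||l lj li]; rewrite mshiftE ?eqxx ?ij ?(negbTE ji).
  - by rewrite /p /s /r; lia.
  - by rewrite /p /r; lia.
  by rewrite ![_ == l]eq_sym (negbTE lj) (negbTE li); lia.
have VY q : (q < r)%N -> V (Y q).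
  move=> qr; rewrite -(mshY q (mshift (r - q) i j m)).
  - by apply: Vl; rewrite -/r; lia.
  - by rewrite mshiftE eqxx ij /s /r; move: qr; rewrite /r; lia.
  - by rewrite mshiftE eqxx (negbTE ji) /r; move: qr; rewrite /r; lia.
  - by move=> l lj li; rewrite mshiftE ![_ == l]eq_sym (negbTE lj) (negbTE li); lia.
have ps : (p <= s)%N by rewrite /p /s /r; lia.
pose z : S := 'X_[Y p] - \sum_(q < r) 'C(p, q)%:R *: coord_change (shear (- 1) j i) 'X_[Y q].
have upz : mspan V z.
  move=> m' /msuppB_le; rewrite mem_cat msuppX mem_seq1 => /predU1P[-> //|].
  move/msupp_sum_le => /flattenP[_ /mapP[q _ ->]] /msuppZ_le.
  rewrite cc_shear_fiber //; last by have := ltn_ord q; rewrite /p; lia.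
  move/msupp_sum_le => /flattenP[_ /mapP[l _ ->]] /msuppZ_le.
  rewrite msuppX mem_seq1 => /eqP ->; apply: VY.
  by have := ltn_ord q; have := ltn_ord l; lia.
have ccz : coord_change (shear 1 j i) z =
    \sum_(l < p.+1 | (r <= l)%N) 'C(p, l)%:R *: 'X_[Y l].
  rewrite /z; set w := \sum_(q < r) _.
  rewrite -scaleN1r ccD ccZ cc_shear_fiber // scaleN1r /w cc_sum.
  rewrite (eq_bigr (fun q : 'I_r => 'C(p, q)%:R *: 'X_[Y q])) => [|q _]; last first.
    by rewrite ccZ cc_comp shearD // subrr shear0 cc1.
  rewrite (eq_bigr (fun l : 'I_p.+1 => 'C(p, l)%:R *: 'X_[Y l])) => [|l _]; last first.
    by rewrite expr1n mulr1.
  rewrite (bigID (fun l : 'I_p.+1 => (r <= l)%N)) /= -addrA [X in _ + X](_ : _ = 0) ?addr0 //.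
  apply/eqP; rewrite subr_eq0; apply/eqP.
  rewrite (big_ord_widen_cond p.+1 predT (fun l => 'C(p, l)%:R *: 'X_[Y l])) /=; last first.
    by rewrite /p; lia.
  by apply: eq_bigl => l; rewrite ltnNge.
have c0 : 'C(p, r)%:R != 0 :> K.
  have /(_ 'C(p, r) 0%N) inj := @natr_inj K charK.
  apply/eqP => /inj /eqP; rewrite -leqn0 leqNgt bin_gt0 /p; lia.
apply/asboolP; exists (coord_change (shear 1 j i) ('C(p, r)%:R^-1 *: z)).
  exists ('C(p, r)%:R^-1 *: z) => // m' /msuppZ_le; exact: upz.
have coefE m' : (coord_change (shear 1 j i) ('C(p, r)%:R^-1 *: z))@_m' =
    'C(p, r)%:R^-1 * \sum_(l < p.+1 | (r <= l)%N) 'C(p, l)%:R * (Y l == m')%:R.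
  rewrite ccZ ccz mcoeffZ raddf_sum /=; congr (_ * _); apply: eq_bigr => l _.
  by rewrite mcoeffZ mcoeffX.
have ltY (l : 'I_p.+1) : (r <= l)%N -> val l != r -> (Y l < Y r)%O.
  move=> rl lr; apply: fiber_lt => //; rewrite ltn_neqAle eq_sym lr rl /=.
  by have := ltn_ord l; lia.
have dY q : (q <= s)%N -> mdeg (Y q) = mdeg m.
  by move=> qs; rewrite Ym !mdeg_fiber // /s /r; lia.
split.
- rewrite ccZ ccz rpredZ //; apply: rpred_sum => l _; rewrite rpredZ // dhomogX /= dY //.
  by have := ltn_ord l; lia.
- have rp : (r < p.+1)%N by rewrite /p; lia.
  rewrite coefE (bigD1 (Ordinal rp)) //= big1 => [|l /andP[rl lr]].
    by rewrite addr0 -Ym eqxx mulr1 mulVf.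
  by have /lt_eqF := ltY l rl lr; rewrite -Ym => ->; rewrite mulr0.
move=> m' lt_m'; rewrite coefE big1 ?mulr0 // => l rl.
have : (Y l <= m)%O.
  have [lr|lr] := eqVneq (val l) r; first by rewrite lr -Ym.
  by rewrite [in X in (_ <= X)%O]Ym ltW // ltY.
by move/le_lt_trans/(_ lt_m')/lt_eqF => ->; rewrite mulr0.
Qed.

End Shear.

Section BitValue.
Context {n : nat}.
Implicit Types (V : pred 'X_{1..n}) (l : seq 'X_{1..n}).

(** The set read as a binary number with the head of [l] as leading bit, so that a lexicographic
    maximum of sets is a maximum of integers. *)
Fixpoint bitval V l := if l is m :: l' then (V m * 2 ^ size l' + bitval V l')%N else 0%N.

Lemma bitval_bound V l : (bitval V l < 2 ^ size l)%N.
Proof. by elim: l => //= m l IH; rewrite expnS; case: (V m); lia. Qed.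

Lemma bitval_lt V V' m0 l : sorted (fun x y => (y < x)%O) l -> m0 \in l ->
    ~~ V m0 -> V' m0 -> {in l, forall m, (m0 < m)%O -> V m -> V' m} ->
  (bitval V l < bitval V' l)%N.
Proof.
elim: l => // m l IH /= pl; rewrite inE => + nV V'0 VV'.
have [<- _|ne /= m0l] := eqVneq m0 m.
  by rewrite (negbTE nV) V'0; have := bitval_bound V l; lia.
have gt_m : (m0 < m)%O.
  have tr : transitive (fun x y : 'X_{1..n} => (y < x)%O).
    by move=> x y z xy yz; apply: lt_trans yz xy.
  by have /allP := order_path_min tr pl; apply.
have := IH (path_sorted pl) m0l nV V'0 (fun x xl => VV' x (mem_behead (s := m :: l) xl)).
have := VV' m (mem_head _ _) gt_m.
by case: (V m) => [/(_ isT) ->|_]; [|case: (V' m)]; lia.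
Qed.

End BitValue.

Section StablePart.
Context {K : fieldType} (charK : [pchar K] =i pred0) {n : nat}.
Local Notation S := {mpoly K[n]}.
Implicit Types (V : pred 'X_{1..n}) (I : set S).

Lemma cnt_hlead_cc I h a : is_homogeneous_ideal I -> h \in unitmx ->
  (cnt a (hlead I) <= cnt a (hlead (coord_change h @` I)))%N.
Proof.
move=> hI uh; have [r [p [<- frp hp]]] := cnt_hlead_lfree I a.
have [idI' _] := cc_ideal uh hI.
apply: (lfree_cnt_hlead idI' _ (lfree_cc uh frp)) => i; have [Ip hpi] := hp i.
by split; [exists (p i) | apply: cc_homog].
Qed.

Lemma cnt_mspan V a : (cnt a V <= cnt a (hlead (mspan V : set S)))%N.
Proof.
apply: sub_cnt => u _ Vu; apply/asboolP; exists 'X_[u]; first exact: mspanX.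
split; first by rewrite dhomogX.
  by rewrite mcoeffX eqxx.
by move=> m' /lt_eqF; rewrite mcoeffX => ->.
Qed.

(* Among the monomial limits of I, one that is maximal for the lexicographic
   comparison of sets of monomials must be strongly stable: a shear
   x_i -> x_i + x_j with j < i would otherwise produce a larger one. *)
Lemma strongly_stable_degeneration I d : is_homogeneous_ideal I ->
  exists V, [/\ upset V, degenerates I (mspan V),
    forall a, (cnt a (hlead I) <= cnt a V)%N & forall a, (a <= d)%N -> sstable a V].
Proof.
move=> hI; have [idI _] := hI.
pose l := sort (fun x y => (y <= x)%O)
  [seq bmnm b | b : 'X_{1..n < d.+1} <- enum {: 'X_{1..n < d.+1}}].
have lP m : (m \in l) = (mdeg m <= d)%N.
  rewrite mem_sort; apply/mapP/idP => [[b _ ->]|dm]; first by rewrite -ltnS bmdeg.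
  by exists (BMultinom (dm : (mdeg m < d.+1)%N)) => //; rewrite mem_enum.
have sl : sorted (fun x y => (y < x)%O) l.
  have : sorted (fun x y => (y <= x)%O) l by apply: sort_sorted => x y; apply: le_total.
  have : uniq l.
    by rewrite sort_uniq map_inj_uniq -?enumT ?enum_uniq // => x y; apply: val_inj.
  elim: l {lP} => // x [//|y l] IH /= /andP[+ ul] /andP[yx pl].
  rewrite inE negb_or => /andP[xy _]; rewrite lt_def xy yx /=; exact: IH.
pose C V := [/\ upset V, degenerates I (mspan V) & forall a, (cnt a (hlead I) <= cnt a V)%N].
pose P k := `[< exists2 V, C V & bitval V l = k >].
have exP : exists k, P k.
  exists (bitval (hlead I) l); apply/asboolP; exists (hlead I) => //; split=> //.
    exact: hlead_upset.
  have := degenerates_hlead charK (degenerates_refl (I := I)) (unitmx1 K n) idI.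
  suff -> : coord_change 1%:M @` I = I by [].
  apply/seteqP; split=> [_ [p Ip <-]|p Ip]; first by rewrite cc1.
  by exists p; rewrite ?cc1.
have leP k : P k -> (k <= 2 ^ size l)%N.
  by case/asboolP => V _ <-; apply/ltnW/bitval_bound.
case: (ex_maxnP exP leP) => k /asboolP[V [upV degV cntV] eVk] maxk.
exists V; split=> // a ad u j i du Vu ji ui; apply: contrapT => /negP nVu.
have ne_ji : j != i by rewrite -val_eqE /=; lia.
pose gap m := ~~ V m && [exists k : 'I_(m j).+1, V (mshift k j i m)].
have exgap : [seq m <- l | gap m] != [::].
  rewrite -has_filter; apply/hasP; exists (mshift 1 i j u).
    by rewrite lP mdeg_mshift // du.
  rewrite /gap nVu; apply/existsP.
  have lt1 : (1 < (mshift 1 i j u j).+1)%N by rewrite mshiftE eqxx; lia.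
  by exists (Ordinal lt1); rewrite /= mshiftK.
have [m0 m0l m0max] : exists2 m0, m0 \in [seq m <- l | gap m] &
    {in [seq m <- l | gap m], forall m, (m <= m0)%O}.
  by apply: seq_least exgap => [x y|y x z yx zy]; [exact: le_total | exact: le_trans zy yx].
have nogap m k' : m \in l -> (m0 < m)%O -> (k' <= m j)%N -> V (mshift k' j i m) -> V m.
  move=> ml gt_m k'm Vk'; apply: contraTT gt_m => nVm; rewrite -leNgt; apply: m0max.
  rewrite mem_filter ml andbT /gap nVm; apply/existsP.
  by exists (Ordinal (k'm : (k' < (m j).+1)%N)).
(* There is no gap above [m0], so trading powers of x_i for x_j in [m] already leads into [V], as
   [shear_lead] requires. *)
have fill m k' : m \in l -> (m0 <= m)%O -> (k' <= m j)%N -> V (mshift k' j i m) ->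
    hlead (coord_change (shear 1 j i : 'M[K]_n) @` mspan V) m.
  move=> ml le_m k'm Vk'; apply: (shear_lead charK ji k'm Vk') => q /andP[q0 qm].
  apply: (nogap _ (q + k')%N).
  - by move: ml; rewrite !lP mdeg_mshift.
  - by apply: le_lt_trans le_m _; apply: mshift_ltmc => //; rewrite q0.
  - by rewrite mshiftE eqxx eq_sym (negbTE ne_ji); lia.
  by rewrite mshift_back 1?eq_sym.
pose V' := hlead (coord_change (shear 1 j i : 'M[K]_n) @` mspan V).
have us : shear 1 j i \in @unitmx K n by apply: shear_unit.
have [idV hV] := mspan_ideal (K := K) upV.
have CV' : C V'.
  have [idV' _] := cc_ideal us (conj idV hV).
  split; first exact: hlead_upset.
    exact: degenerates_hlead us idV.
  move=> a'; apply: leq_trans (cntV a') _; apply: leq_trans (cnt_mspan V a') _.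
  exact: cnt_hlead_cc (conj idV hV) us.
have PV' : P (bitval V' l) by apply/asboolP; exists V'.
have := maxk _ PV'; apply/negP; rewrite -ltnNge -eVk.
move: m0l; rewrite mem_filter => /andP[/andP[nV0 /existsP[k0 Vk0]] m0l].
(* [V'] gains [m0] and, by shifts with exponent 0, keeps the elements of [V] above it: its value
   exceeds the maximum. *)
apply: (bitval_lt sl m0l nV0) => [|m ml gt_m Vm].
  by apply: (fill _ k0) => //; rewrite -ltnS.
apply: (fill _ 0%N) => //; first exact: ltW.
by rewrite mshift0.
Qed.

End StablePart.

(** * Products in generic coordinates *)

Section GenericProduct.
Context {K : fieldType} (charK : [pchar K] =i pred0) {n : nat}.
Local Notation S := {mpoly K[n]}.
Implicit Types (V W : pred 'X_{1..n}) (I J : set S).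

Lemma mcoeff_horner (Q : {poly S}) (t : K) m :
  (map_poly (mcoeff m) Q).[t] = (Q.[t%:MP])@_m.
Proof.
rewrite (@horner_coef_wide _ (size Q)) ?size_poly // horner_coef raddf_sum /=.
apply: eq_bigr => i _; rewrite coef_map_id0 ?mcoeff0 //.
by rewrite -rmorphXn /= mulrC [in RHS]mulrC mcoeffCM.
Qed.

Lemma polylike_det r (c : 'I_r -> S) (m : 'I_r -> 'X_{1..n}) :
  polylike (fun p : 'I_r -> S => \det (\matrix_(k, l) (c k * p k)@_(m l))).
Proof.
move=> P; exists (\det (\matrix_(k, l) map_poly (mcoeff (m l)) ((c k)%:P * P k))).
move=> t; rewrite -horner_evalE -det_map_mx; congr (\det _); apply/matrixP => k l.
by rewrite !mxE /= /horner_eval mcoeff_horner hornerM hornerC.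
Qed.

Lemma det_mcoeff_mulC r (c p : 'I_r -> S) (m : 'I_r -> 'X_{1..n}) :
  \det (\matrix_(k, l) (c k * p k)@_(m l)) = \det (\matrix_(k, l) (p k * c k)@_(m l)).
Proof. by congr (\det _); apply/matrixP => k l; rewrite !mxE mulrC. Qed.

Lemma det_lfree r (p : 'I_r -> S) (m : 'I_r -> 'X_{1..n}) :
  \det (\matrix_(k, l) (p k)@_(m l)) != 0 -> lfree p.
Proof.
move=> det0 c sum0 i; apply/eqP; apply: contraNT det0 => ci; apply/det0P.
exists (\row_k c k).
  by apply: contra_neq ci => /rowP/(_ i); rewrite !mxE.
apply/rowP => l; have := congr1 (mcoeff (m l)) sum0.
rewrite mcoeff0 raddf_sum /= => e; rewrite !mxE -[RHS]e; apply: eq_bigr => k _.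
by rewrite !mxE mcoeffZ.
Qed.

Definition rev_mx : 'M[K]_n := \matrix_(i, j) (i == rev_ord j)%:R.

Lemma cc_rev_mx m : coord_change rev_mx 'X_[m] = 'X_[mrev m] :> S.
Proof.
rewrite ccXE mpolyXE_id [RHS](reindex_inj rev_ord_inj) /=; apply: eq_bigr => i _.
rewrite mrevE rev_ordK; congr (_ ^+ _); rewrite (bigD1 (rev_ord i)) //= mxE eqxx scale1r.
by rewrite big1 ?addr0 // => j ji; rewrite mxE (negbTE ji) scale0r.
Qed.

Lemma rev_mx_unit : rev_mx \in unitmx.
Proof.
have /mulmx1_unit[] // : rev_mx *m rev_mx = 1%:M.
apply/matrixP => i j; rewrite !mxE (bigD1 (rev_ord j)) //= !mxE eqxx mulr1 rev_ordK.
by rewrite big1 ?addr0 // => k ne; rewrite !mxE (negbTE ne) mulr0.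
Qed.

(** A nonvanishing determinant is carried through the two degenerations in turn, the other factor
    being fixed. It starts as the determinant of the identity matrix, since the chosen products of
    monomials are distinct. *)
Lemma generic_product_lfree I J V W d : degenerates I (mspan V) ->
    degenerates (coord_change rev_mx @` J) (mspan W) ->
  exists g (p q : 'I_(cnt d (mprod V (W \o mrev))) -> S),
    [/\ g \in unitmx,
        forall k, exists a b, [/\ I (p k), J (q k), p k \is (a.-homog), q k \is (b.-homog)
          & (a + b)%N = d]
      & lfree (fun k => p k * coord_change g (q k))].
Proof.
move=> degV degW; rewrite /cnt -size_filter; set s := filter _ _.
pose m k := nth 0%MM s k.
have mP (k : 'I_(size s)) : exists uw, [/\ V uw.1, W uw.2, (mdeg uw.1 + mdeg uw.2 = d)%N
    & m k = (uw.1 + mrev uw.2)%MM].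
  have : m k \in s by rewrite mem_nth.
  rewrite mem_filter mem_monos => /andP[/asboolP[u [v [Vu Wv em]]] /eqP dm].
  exists (u, mrev v); split=> //=; last by rewrite mrevK.
  by rewrite mdeg_mrev -dm em mdegD.
have [uw uwP] := choice mP.
pose u k := (uw k).1; pose w k := (uw k).2.
have m_inj (k l : 'I_(size s)) : (m k == m l) = (k == l).
  by rewrite nth_uniq ?filter_uniq ?monos_uniq.
pose F1 (p : 'I_(size s) -> S) := \det (\matrix_(k, l) ('X_[mrev (w k)] * p k)@_(m l)).
have F1u : F1 (fun k => 'X_[u k]) != 0.
  rewrite /F1 (_ : \matrix_(_, _) _ = 1%:M) ?det1 ?oner_neq0 //.
  apply/matrixP => k l; rewrite !mxE -mpolyXD mcoeffX addmC.
  by have [_ _ _ <-] := uwP k; rewrite m_inj.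
have [|g [p [ug Ip F1p]]] := degV _ (fun k => mdeg (u k)) _ _ (polylike_det _ _) _ F1u.
  by move=> k; have [Vu _ _ _] := uwP k; split; [exact: mspanX | rewrite dhomogX].
pose F2 (q : 'I_(size s) -> S) := \det (\matrix_(k, l) (coord_change g (p k) * q k)@_(m l)).
have F2w : F2 (fun k => coord_change rev_mx 'X_[w k]) != 0.
  have -> : (fun k => coord_change rev_mx 'X_[w k]) = (fun k => 'X_[mrev (w k)] : S).
    by apply/funext => k; apply: cc_rev_mx.
  by rewrite /F2 det_mcoeff_mulC.
have [|h [q [uh Jq F2q]]] := degW _ (fun k => mdeg (w k)) _ _
    (polylike_cc rev_mx (polylike_det _ _)) _ F2w.
  by move=> k; have [_ Ww _ _] := uwP k; split; [exact: mspanX | rewrite dhomogX].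
have exq' k : exists y, J y /\ coord_change rev_mx y = q k.
  by have [[y Jy <-] _] := Jq k; exists y.
have [q' q'P] := choice exq'.
(* The independent products have g on the first factor and [rev_mx *m h *m rev_mx] on the second;
   the inverse of g, applied to both, frees the first. *)
pose g1 := invmx g *m rev_mx *m h *m rev_mx.
have q'E k : coord_change g1 (q' k) =
    coord_change (invmx g) (coord_change rev_mx (coord_change h (q k))).
  by rewrite /g1 -!cc_comp; have [_ ->] := q'P k.
exists g1, p, q'; split.
- by rewrite !unitmx_mul unitmx_inv ug uh rev_mx_unit.
- move=> k; have [Ik hk] := Ip k; have [Jk eq'] := q'P k.
  have [_ _ duw _] := uwP k; exists (mdeg (u k)), (mdeg (w k)); split=> //.
  by rewrite -(ccK rev_mx_unit (q' k)) eq'; apply: cc_homog; case: (Jq k).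
have /(lfree_cc _) : lfree (fun k => coord_change g (p k) *
    coord_change rev_mx (coord_change h (q k))) by exact: det_lfree F2q.
have uig : invmx g \in unitmx by rewrite unitmx_inv.
move/(_ _ uig); congr lfree; apply/funext => k.
by rewrite [LHS]ccM (ccK ug) q'E.
Qed.

End GenericProduct.

(** Induction on the number [c] of coordinates compared. A finite set [s] for [c] coordinates also
    serves when the next exponent is at least [B], its maximum over [s]; each of the finitely many
    smaller values gets a finite set of its own. *)
Lemma dickson n (P : 'X_{1..n} -> Prop) : exists s : seq 'X_{1..n},
  (forall u, u \in s -> P u) /\ forall m, P m -> exists2 u, u \in s & (u <= m)%MM.
Proof.
suff H c (Q : 'X_{1..n} -> Prop) : exists s : seq 'X_{1..n},
    (forall u, u \in s -> Q u) /\ forall m, Q m ->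
    exists2 u, u \in s & forall i : 'I_n, (i < c)%N -> (u i <= m i)%N.
  have [s [sP sH]] := H n P; exists s; split=> // m /sH[u us um].
  by exists u => //; apply/mnm_lepP => i; apply: um.
elim: c Q => [|c IH] Q.
  have [[m Qm]|nQ] := pselect (exists m, Q m); last first.
    by exists [::]; split=> // m Qm; case: nQ; exists m.
  by exists [:: m]; split=> [u|m' _]; [rewrite inE => /eqP -> | exists m; rewrite ?mem_head].
have [nc|cn] := leqP n c.
  have [s [sP sH]] := IH Q; exists s; split=> // m /sH[u us um]; exists u => // i _.
  by apply: um; apply: leq_trans nc.
pose o := Ordinal cn.
have ltS (i : 'I_n) : (i < c.+1)%N -> i = o \/ (i < c)%N.
  by rewrite ltnS leq_eqVlt => /predU1P[e|]; [left; apply: val_inj|right].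
have [s [sP sH]] := IH Q.
pose B := \max_(u <- s) u o.
have [t tP] := choice (fun b => IH (fun m => Q m /\ m o = b)).
exists (s ++ flatten [seq t b | b <- iota 0 B]); split=> [u|m Qm].
  rewrite mem_cat => /orP[/sP //|/flattenP[_ /mapP[b _ ->]] ut].
  by have [+ _] := tP b => /(_ u ut)[].
have [mB|mB] := ltnP (m o) B.
  have [_ /(_ m (conj Qm erefl))[u ut um]] := tP (m o).
  exists u.
    rewrite mem_cat; apply/orP; right; apply/flattenP; exists (t (m o)) => //.
    by apply: map_f; rewrite mem_iota.
  move=> i /ltS[->|/um //]; have [+ _] := tP (m o).
  by move=> /(_ u ut)[_ ->].
have [u us um] := sH m Qm; exists u; first by rewrite mem_cat us.
move=> i /ltS[->|/um //]; apply: leq_trans mB.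
by rewrite /B (big_rem u) //= leq_maxl.
Qed.

(** * Forms depending polynomially on the matrix, and the open set *)

Section Generic.
Context {K : fieldType} (charK : [pchar K] =i pred0) {n : nat}.
Local Notation S := {mpoly K[n]}.
Local Notation R := {mpoly K[n * n]}.
Implicit Types (g h : 'M[K]_n) (I J : set S) (f : R).

(* Kronecker substitution x_k := t ^ (B ^ (N - k)). *)
Lemma mpoly_nonroot N (f : {mpoly K[N]}) : f != 0 -> exists x, f.@[x] != 0.
Proof.
move=> f0; pose B := msize f.
pose F : {poly K} := \sum_(m <- msupp f) f@_m *: 'X^(wt B m).
have [t _ Ft] : exists2 t, t != 0 & F.[t] != 0.
  apply: (poly_nonroot charK); have := mlead_supp f0; set m0 := mlead f => m0f.
  suff : F`_(wt B m0) != 0 by apply: contraNneq => ->; rewrite coef0.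
  rewrite coef_sum (bigD1_seq m0) ?msupp_uniq //= big_seq_cond big1 ?addr0.
    by rewrite coefZ coefXn eqxx mulr1 -mcoeff_msupp.
  move=> m /andP[mf ne]; rewrite coefZ coefXn; case: eqP; rewrite ?mulr0 //.
  move/wt_inj => e; case/eqP: ne; apply/esym/e; exact: msize_mdeg_lt.
exists (fun k => t ^+ (B ^ (N - k))); move: Ft; congr (_ != 0).
rewrite mevalE horner_sum; apply: eq_bigr => m _; rewrite hornerZ hornerXn; congr (_ * _).
rewrite /wt; elim/big_rec2: _ => [|i y1 y2 _ <-]; first by rewrite expr0.
by rewrite exprD mulnC exprM.
Qed.

Definition mxeval g f : K := f.@[mxvec g 0].

Lemma mxeval_nonroot f : f != 0 -> exists g, mxeval g f != 0.
Proof.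
case/mpoly_nonroot => x fx; exists (vec_mx (\row_k x k)).
rewrite /mxeval vec_mxK; suff -> : f.@[(\row_k x k) 0] = f.@[x] by [].
by apply: meval_eq => k; rewrite mxE.
Qed.

Definition generic_det : R := \det (\matrix_(i, j) 'X_(mxvec_index i j)).

Lemma mxeval_det g : mxeval g generic_det = \det g.
Proof.
rewrite /mxeval /generic_det -det_map_mx; congr (\det _); apply/matrixP => i j.
by rewrite !mxE /= mevalXU mxvecE.
Qed.

Lemma generic_det_neq0 : generic_det != 0.
Proof.
have : mxeval 1%:M generic_det != 0 by rewrite mxeval_det det1 oner_neq0.
by apply: contraNneq => ->; rewrite /mxeval meval0.
Qed.

Definition polyfun (phi : 'M[K]_n -> K) := exists f, forall g, phi g = mxeval g f.

Lemma polyfun_cst c : polyfun (fun=> c).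
Proof. by exists c%:MP => g; rewrite /mxeval mevalC. Qed.

Lemma polyfunM phi psi : polyfun phi -> polyfun psi -> polyfun (fun g => phi g * psi g).
Proof. by move=> [f1 e1] [f2 e2]; exists (f1 * f2) => g; rewrite e1 e2 /mxeval mevalM. Qed.

Lemma polyfun_sum T (r : seq T) (P : pred T) (phi : T -> 'M[K]_n -> K) :
  (forall x, polyfun (phi x)) -> polyfun (fun g => \sum_(x <- r | P x) phi x g).
Proof.
move=> pphi; have [f fP] := choice pphi; exists (\sum_(x <- r | P x) f x) => g.
by rewrite /mxeval raddf_sum /=; apply: eq_bigr => x _; rewrite fP.
Qed.

Definition polyfam (P : 'M[K]_n -> S) := forall m, polyfun (fun g => (P g)@_m).

Lemma polyfam_cst p : polyfam (fun=> p).
Proof. by move=> m; apply: polyfun_cst. Qed.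

Lemma polyfamM P Q : polyfam P -> polyfam Q -> polyfam (fun g => P g * Q g).
Proof.
move=> pP pQ m; have [f fP] : polyfun (fun g => \sum_(k : 'X_{1..n < (mdeg m).+1, (mdeg m).+1}
    | m == (k.1 + k.2)%MM) ((P g)@_k.1 * (Q g)@_k.2)).
  by apply: polyfun_sum => k; apply: polyfunM.
by exists f => g; rewrite -fP mcoeffM.
Qed.

Lemma polyfam_sum T (r : seq T) (F : T -> 'M[K]_n -> S) :
  (forall x, polyfam (F x)) -> polyfam (fun g => \sum_(x <- r) F x g).
Proof.
move=> pF m; have [f fP] := polyfun_sum r predT (fun x => pF x m).
by exists f => g; rewrite -fP raddf_sum.
Qed.

Lemma polyfamZ phi P : polyfun phi -> polyfam P -> polyfam (fun g => phi g *: P g).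
Proof.
move=> pphi pP m; have [f fP] := polyfunM pphi (pP m).
by exists f => g; rewrite -fP mcoeffZ.
Qed.

Lemma eq_polyfam P Q : P =1 Q -> polyfam P -> polyfam Q.
Proof. by move=> /funext ->. Qed.

Lemma polyfam_prod T (r : seq T) (F : T -> 'M[K]_n -> S) :
  (forall x, polyfam (F x)) -> polyfam (fun g => \prod_(x <- r) F x g).
Proof.
move=> pF; elim: r => [|x r IH].
  by apply: eq_polyfam (polyfam_cst 1) => g; rewrite big_nil.
by apply: eq_polyfam (polyfamM (pF x) IH) => g; rewrite big_cons.
Qed.

Lemma polyfam_exp P k : polyfam P -> polyfam (fun g => P g ^+ k).
Proof.
move=> pP; elim: k => [|k IH].
  by apply: eq_polyfam (polyfam_cst 1) => g; rewrite expr0.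
by apply: eq_polyfam (polyfamM pP IH) => g; rewrite exprS.
Qed.

Lemma polyfam_cc p : polyfam (fun g => coord_change g p).
Proof.
apply: (@eq_polyfam (fun g => \sum_(m <- msupp p)
    p@_m *: \prod_(i < n) (\sum_(j < n) g j i *: 'X_j) ^+ m i)) => [g|].
  rewrite [in RHS](mpolyE p) (cc_sum g); apply: eq_bigr => m _; rewrite ccZ.
  by rewrite ccXE.
apply: polyfam_sum => m; apply: polyfamZ; first exact: polyfun_cst.
apply: polyfam_prod => i; apply: polyfam_exp; apply: polyfam_sum => j.
apply: polyfamZ; last exact: polyfam_cst.
by exists 'X_(mxvec_index j i) => g; rewrite /mxeval mevalXU mxvecE.
Qed.

(** Membership is asked at every matrix, singular ones included, so that families can be combined
    with coefficients polynomial in g. *)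
Definition prodfam I J d (P : 'M[K]_n -> S) :=
  polyfam P /\ forall g, ideal_mul I (coord_change g @` J) (P g) /\ P g \is d.-homog.

(* The leading monomials of I g(J) for a generic matrix g. *)
Definition generic_lead I J : pred 'X_{1..n} := fun m => `[< exists P,
  [/\ prodfam I J (mdeg m) P, exists g, (P g)@_m != 0
    & forall m' g, (m < m')%O -> (P g)@_m' = 0] >].

(** The argument of [lfree_cnt_hlead] over the polynomials in the entries of g. If there were too
    few generic leading monomials, a combination [Q], not identically 0, would have coefficient 0 at
    all of them; but the greatest monomial that ever occurs in [Q] is one of them. *)
Lemma prodfam_cnt I J d r (P : 'I_r -> 'M[K]_n -> S) g0 :
    (forall k, prodfam I J d (P k)) -> lfree (fun k => P k g0) ->
  (r <= cnt d (generic_lead I J))%N.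
Proof.
move=> hP frP; rewrite leqNgt; apply/negP; rewrite /cnt -size_filter.
set s := filter _ _ => lt_r.
have exf k m : exists f, forall g, (P k g)@_m = mxeval g f by have [pP _] := hP k; exact: pP.
have [f fP] : exists f : 'I_r -> 'X_{1..n} -> R, forall k m g, (P k g)@_m = mxeval g (f k m).
  have [f fP] := choice (fun km => exf km.1 km.2); exists (fun k m => f (k, m)).
  by move=> k m g; apply: (fP (k, m)).
have [v v0 vM] := @left_kernel_neq0 R r (size s) (\matrix_(i, j) f i (nth 0%MM s j)) lt_r.
pose Q g := \sum_k mxeval g (v 0 k) *: P k g.
have hQ : prodfam I J d Q.
  split; first by apply: polyfam_sum => k; apply: polyfamZ;
    [exists (v 0 k) | case: (hP k)].
  move=> g; split; last by apply: rpred_sum => k _; apply: rpredZ; case: (hP k) => _ /(_ g)[].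
  apply: ideal_sum => [|k _]; first exact: ideal_mul_ideal.
  by apply: idealZ; [exact: ideal_mul_ideal | case: (hP k) => _ /(_ g)[]].
pose t := size (monos d : seq 'X_{1..n}).
pose A : 'M[R]_(r, t) := \matrix_(k, l) f k (nth 0%MM (monos d) l).
pose A0 := map_mx (mxeval g0) A.
have frA0 : row_free A0.
  apply: inj_row_free => c cA0; apply/rowP => k; rewrite [RHS]mxE; apply: (frP (fun k => c 0 k)).
  apply/mpolyP => m; rewrite mcoeff0 raddf_sum /=.
  have [dm|dm] := boolP (m \in monos d : bool); last first.
    rewrite big1 // => l _; rewrite mcoeffZ (@dhomog_nemf_coeff _ _ mdeg d) ?mulr0 //.
      by case: (hP l) => _ /(_ g0)[].
    by rewrite -mem_monos.
  have lt_m : (index m (monos d) < t)%N by rewrite index_mem.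
  have := congr1 (fun w : 'rV_t => w 0 (Ordinal lt_m)) cA0; rewrite !mxE => e.
  rewrite -[RHS]e; apply: eq_bigr => l _.
  by rewrite mcoeffZ !mxE /= nth_index // fP.
(* [pinvmx A0] is a right inverse of [A0], so [D] takes the value 1 at [g0]. It acts as a nonzero
   maximal minor of [A]: where it does not vanish, the [P k] are independent. *)
pose D : R := \det (A *m map_mx (@mpolyC (n * n) K) (pinvmx A0)).
have DE g : mxeval g D = \det (map_mx (mxeval g) A *m pinvmx A0).
  rewrite /mxeval /D -det_map_mx map_mxM; congr (\det (_ *m _)).
  by apply/matrixP => i j; rewrite !mxE /= mevalC.
have D0 : D != 0.
  have : mxeval g0 D != 0 by rewrite DE -/A0 mulmxVp // det1 oner_neq0.
  by apply: contraNneq => ->; rewrite /mxeval meval0.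
have [k vk] : exists k, v 0 k != 0.
  apply: contrapT => nex; case/eqP: v0; apply/rowP => k; rewrite mxE; apply/eqP.
  by apply: contrapT => /negP ?; apply: nex; exists k.
have [g] := mxeval_nonroot (mulf_neq0 D0 vk).
rewrite /mxeval mevalM mulf_eq0 negb_or -!/(mxeval g _) => /andP[Dg vg].
have Qg : Q g != 0.
  apply: contraNneq Dg => Qg0; rewrite DE; apply/det0P.
  exists (map_mx (mxeval g) v); first by apply: contra_neq vg => /rowP/(_ k); rewrite !mxE.
  rewrite mulmxA; suff -> : map_mx (mxeval g) v *m map_mx (mxeval g) A = 0 by rewrite mul0mx.
  apply/rowP => l; have := congr1 (mcoeff (nth 0%MM (monos d) l)) Qg0.
  rewrite mcoeff0 raddf_sum /= => e; rewrite !mxE -[RHS]e; apply: eq_bigr => i _.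
  by rewrite !mxE mcoeffZ fP.
(* The maximum is taken over all matrices together, because [generic_lead] asks for vanishing above
   [m] at every matrix. *)
pose live m := `[< exists g, (Q g)@_m != 0 >].
have exm : (0 < cnt d live)%N.
  apply/cnt_gt0P; exists (mlead (Q g)); last by apply/asboolP; exists g; rewrite mleadc_eq0.
  by have [_ /(_ g)[_ hQg]] := hQ; have [] := homog_lead Qg hQg.
have [m ms mmax] : exists2 m, m \in [seq m <- monos d | live m] &
    {in [seq m <- monos d | live m], forall m', (m' <= m)%O}.
  apply: seq_least => [x y|y x z yx zy|]; [exact: le_total | exact: le_trans zy yx |].
  by rewrite -size_eq0 size_filter -lt0n.
move: ms; rewrite mem_filter mem_monos => /andP[/asboolP[g1 Qm] /eqP dm].
have lm : m \in s.
  rewrite mem_filter mem_monos dm eqxx andbT; apply/asboolP; exists Q; rewrite dm.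
  split=> //; first by exists g1.
  move=> m' g' lt_m'; apply/eqP; apply: contraTT lt_m' => Qm'; rewrite -leNgt.
  apply: mmax; rewrite mem_filter mem_monos; apply/andP; split; first by apply/asboolP; exists g'.
  apply: contraNT Qm' => dm'; apply/eqP; apply: dhomog_nemf_coeff dm'.
  by have [_ /(_ g')[]] := hQ.
case/eqP: Qm; rewrite raddf_sum /=.
have lt_m : (index m s < size s)%N by rewrite index_mem.
have := congr1 (fun w : 'rV_(size s) => mxeval g1 (w 0 (Ordinal lt_m))) vM.
rewrite /= !mxE /mxeval meval0 raddf_sum /= => e; rewrite -[RHS]e; apply: eq_bigr => i _.
by rewrite mcoeffZ !mxE /= nth_index // fP mevalM.
Qed.

(** Leading monomials of an ideal are closed under multiples, so it is enough to keep the leading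
    coefficients at Dickson's finitely many monomials nonzero; [f] is the product of these
    coefficients. *)
Lemma generic_lead_open I J : exists f, f != 0 /\ forall g, mxeval g f != 0 ->
  forall m, generic_lead I J m -> hlead (ideal_mul I (coord_change g @` J)) m.
Proof.
have [s [sP sdiv]] := dickson (fun m => generic_lead I J m).
have exf u : exists f, generic_lead I J u -> f != 0 /\ forall g, mxeval g f != 0 ->
    hlead (ideal_mul I (coord_change g @` J)) u.
  have [/asboolP[P [[pP hP] [g0 Pg0] Pgt]]|ngu] := boolP (generic_lead I J u); last by exists 1.
  have [f fP] := pP u; exists f => _; split.
    by apply: contraNneq Pg0 => f0; rewrite fP f0 /mxeval meval0.
  move=> g fg; apply/asboolP; have [IP homP] := hP g.
  exists ((mxeval g f)^-1 *: P g); first by apply: idealZ; first exact: ideal_mul_ideal.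
  split; [exact: rpredZ | by rewrite mcoeffZ fP mulVf|].
  by move=> m' lt_m'; rewrite mcoeffZ Pgt // mulr0.
have [f fP] := choice exf.
exists (\prod_(u <- s) f u); split.
  by rewrite prodf_seq_neq0; apply/allP => u /sP/fP[].
move=> g; rewrite /mxeval rmorph_prod /= prodf_seq_neq0 => /allP fg m.
case/sdiv => u us um; rewrite -(submK um) addmC; apply: hlead_upset.
  exact: ideal_mul_ideal.
by have [_] := fP u (sP u us); apply; apply: fg.
Qed.

End Generic.

(** * Monomial, lex and opposite lex ideals as sets of monomials *)

Section MonomialIdeals.
Context {K : fieldType} {n : nat}.
Local Notation S := {mpoly K[n]}.
Implicit Types (I L : set S) (m u v : 'X_{1..n}).

Definition mon_of L : pred 'X_{1..n} := fun m => `[< L 'X_[m] >].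

Lemma mon_of_upset L : is_ideal L -> upset (mon_of L).
Proof.
move=> [_ _ LM] u m /asboolP Lu; apply/asboolP.
by rewrite mpolyXD mulrC; apply: LM.
Qed.

Lemma monomial_idealE L : is_monomial_ideal L -> L = mspan (mon_of L).
Proof.
move=> [M eL]; have idL : is_ideal L by rewrite eL; apply: ideal_gen_ideal.
have genL u : M u -> L 'X_[u].
  move=> Mu; rewrite eL; exists [:: (1, 'X_[u])]; rewrite big_seq1 mul1r; split=> // x.
  by rewrite inE => /eqP ->; exists u.
apply/seteqP; split=> p; last first.
  move=> Lp; rewrite (mpolyE p) big_seq; apply: ideal_sum => // m /Lp /asboolP.
  exact: idealZ.
rewrite {1}eL => -[s [hs ->]] m /msupp_sum_le /flattenP[_ /mapP[x + ->]].
rewrite filter_predT => /hs[u Mu <-]; rewrite (perm_mem (msuppMX _ _)).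
case/mapP => m' _ ->; apply: mon_of_upset => //; apply/asboolP; exact: genL.
Qed.

Lemma mprod_ideal_mul L L' m : is_monomial_ideal L -> is_monomial_ideal L' ->
  hlead (ideal_mul L L') m -> mprod (mon_of L) (mon_of L') m.
Proof.
move=> mL mL' /asboolP[p [s [hs ->]] [_ pm _]].
have idL : is_ideal L by case: mL => M ->; apply: ideal_gen_ideal.
have : m \in msupp (\sum_(x <- s) x.1 * x.2) by rewrite mcoeff_msupp pm oner_neq0.
move/msupp_sum_le => /flattenP[_ /mapP[x + ->]]; rewrite filter_predT.
move=> /hs[q Lq [q' Lq' <-]] /msuppM_le /allpairsP[[m1 m2] [/= _ + ->]].
move/msuppM_le /allpairsP => [[u v] [/= qu qv ->]].
rewrite {}(monomial_idealE mL) in Lq; rewrite {}(monomial_idealE mL') in Lq'.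
apply/asboolP; exists (u + m1)%MM, v; split; [| exact: Lq'|].
  by apply: mon_of_upset => //; exact: Lq.
by apply/mnmP => i; rewrite !mnmDE addnCA addnA.
Qed.

Lemma cnt_mon_of L d : (cnt d (mon_of L) <= cnt d (hlead L))%N.
Proof.
apply: sub_cnt => u _ /asboolP Lu; apply/asboolP; exists 'X_[u] => //.
split; first by rewrite dhomogX.
  by rewrite mcoeffX eqxx.
by move=> m' /lt_eqF; rewrite mcoeffX => ->.
Qed.

Lemma lex_gtP u v : mdeg u = mdeg v -> lex_gt v u = (u < v)%O.
Proof. by move=> duv; apply/ltxi_tuplePlt/(ltmcP duv). Qed.

Lemma lex_lexseg L d : segment_closed (@lex_gt n) [set m | L 'X_[m]] ->
  lexseg n d (mon_of L).
Proof.
move=> sL u v du dv _ _ /asboolP Lu uv; apply/asboolP.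
by apply: (sL u v); rewrite ?lex_gtP ?du ?dv.
Qed.

Lemma oplex_lexseg L d : segment_closed (@oplex_gt n) [set m | L 'X_[m]] ->
  lexseg n d (mon_of L \o mrev).
Proof.
move=> sL u v du dv _ _ /asboolP Lu uv; apply/asboolP.
apply: (sL (mrev u) (mrev v)) => //; rewrite ?mdeg_mrev ?du ?dv //.
have -> : oplex_gt (mrev v) (mrev u) = lex_gt (mrev (mrev v)) (mrev (mrev u)) by [].
by rewrite !mrevK lex_gtP // du dv.
Qed.

End MonomialIdeals.

Theorem theorem1p4 (K : fieldType) (charK : [pchar K] =i pred0) (n : nat)
    (I J : set {mpoly K[n.+1]})
    (homI : is_homogeneous_ideal I) (homJ : is_homogeneous_ideal J)
    (Ilex Joplex : set {mpoly K[n.+1]})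
    (lexI : is_lex_of I Ilex) (oplexJ : is_oplex_of J Joplex) :
  for_general (fun g : 'M[K]_n.+1 => forall d : nat,
    (hilbert (ideal_mul I (coord_change g @` J)) d
       >= hilbert (ideal_mul Ilex Joplex) d)%N).
Proof.
case: lexI => -[mL sL] hilbL; case: oplexJ => -[mO sO] hilbO.
have [idI _] := homI; have [idJ _] := homJ.
have idL : is_ideal Ilex by case: mL => M ->; apply: ideal_gen_ideal.
have idO : is_ideal Joplex by case: mO => M ->; apply: ideal_gen_ideal.
have idM I1 J1 : is_ideal (@ideal_mul K n.+1 I1 J1) by apply: ideal_mul_ideal.
suff main d : (cnt d (mprod (mon_of Ilex) (mon_of Joplex)) <= cnt d (generic_lead I J))%N.
  have [f [f0 hf]] := generic_lead_open I J.
  exists [set g | g \in unitmx /\ mxeval g f != 0]; split.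
  - exists [set f] => g; split=> [[ug fg]|[ug [_ -> fg]]]; last by [].
    by split=> //; exists f.
  (* A point where [f] times the generic determinant does not vanish is an invertible matrix in the
     open set. *)
  - have [g] := mxeval_nonroot charK (mulf_neq0 f0 (@generic_det_neq0 K n.+1)).
    rewrite {1}/mxeval mevalM mulf_eq0 negb_or -!/(mxeval _ _) mxeval_det => /andP[fg dg].
    by exists g; split=> //; rewrite unitmxE unitfE.
  move=> g [_ fg] d; rewrite !hilbert_cnt_hlead //.
  apply: (@leq_trans (cnt d (mprod (mon_of Ilex) (mon_of Joplex)))).
    by apply: sub_cnt => m _; apply: mprod_ideal_mul.
  apply: leq_trans (main d) _; apply: sub_cnt => m _; exact: hf.
(* J is degenerated after reversal of the variables, which turns opposite lex into lex; [mrev]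
   undoes the reversal on monomials. *)
have homJ' := cc_ideal (@rev_mx_unit K n.+1) homJ.
have [V [upV degV cntV stV]] := strongly_stable_degeneration charK d homI.
have [W [upW degW cntW stW]] := strongly_stable_degeneration charK d homJ'.
have leVW : (cnt d (mprod (mon_of Ilex) (mon_of Joplex)) <= cnt d (mprod V (W \o mrev)))%N.
  have -> : mon_of Joplex = (mon_of Joplex \o mrev) \o mrev.
    by apply/funext => m /=; rewrite mrevK.
  apply: cnt_mprod_lexseg => //; [exact: mon_of_upset | |move=> a ad..].
  - exact/upset_mrev/mon_of_upset.
  - split; [exact: stV | exact: lex_lexseg |].
    apply: leq_trans (cntV a); apply: leq_trans (cnt_mon_of _ _) _.
    by rewrite -!hilbert_cnt_hlead // -hilbL.
  - split; [exact: stW | exact: oplex_lexseg |].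
    apply: leq_trans (cntW a); rewrite cnt_mrev; apply: leq_trans (cnt_mon_of _ _) _.
    rewrite -hilbert_cnt_hlead // hilbO hilbert_cnt_hlead //.
    exact: cnt_hlead_cc homJ (@rev_mx_unit K n.+1).
apply: leq_trans leVW _.
have [g [p [q [_ hpq frpq]]]] := generic_product_lfree d degV degW.
(* The forms found for one [g] are kept while the matrix varies: their products become polynomial
   families, independent at [g]. *)
apply: (prodfam_cnt charK (P := fun k h => p k * coord_change h (q k)) (g0 := g)) => // k.
have [a [b [Ip Jq hp hq <-]]] := hpq k.
split; first by apply: polyfamM; [exact: polyfam_cst | exact: polyfam_cc].
move=> h; split; first by apply: ideal_mulM => //; exists (q k).
by apply: dhomogM => //; apply: cc_homog.
Qed.
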